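(* Let $l, g, \mu > 0$ be real constants, let $\xi \colon \mathbb{R} \to \mathbb{R}$ be a twice differentiable function whose second derivative $\ddot\xi$ is Lipschitz, and let $t_0 \in \mathbb{R}$. Consider the system $$ \dot q = p, \qquad \dot p = \frac{\ddot\xi(t)}{l}\sin q - \frac{\mu}{l}\left|\ddot\xi(t)\cos q - l p^2 + g \sin q\right|\frac{p}{|p|} - \frac{g}{l}\cos q, $$ with solutions understood in the sense of the associated differential inclusion $(\dot q,\dot p)\in\Phi(q,p,t)$. Suppose that $\mu|\ddot\xi(t)|<g$ for all $t\geqslant t_0$. Then there exist $q_0 \in (0,\pi)$ and $p_0 \in \mathbb{R}$ such that the solution $(q(t),p(t))$ with initial conditions $q(t_0)=q_0$, $p(t_0)=p_0$ satisfies $q(t)\in(0,\pi)$ for all $t>t_0$.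
   Context: The system describes an inverted planar pendulum of length $l$ in a gravitational field with acceleration $g$, with Coulomb dry friction coefficient $\mu$, whose pivot moves along a horizontal line according to the given law $\xi(t)$; $q$ is the angle between the horizontal line and the rod ($q=0$ and $q=\pi$ are the horizontal positions). The right-hand side is $2\pi$-periodic in $q$; here $q$ is regarded as a real-valued coordinate. The right-hand side $f(q,p,t)$ of the system is undefined (discontinuous) on the plane $M=\{p=0\}$. The associated set-valued map $\Phi$ is defined as follows: $\Phi(q,p,t)\subset\mathbb{R}^2$ is the smallest closed convex set containing all limit values of $f(q^*,p^*,t)$ as $(q^*,p^* )\to(q,p)$ with $p^*\neq 0$. Explicitly, $\Phi(q,p,t)=\{f(q,p,t)\}$ for $p\ne 0$, and $$ \Phi(q,0,t)=\{0\}\times\left[a-b,\;a+b\right],\quad a=\frac{\ddot\xi(t)}{l}\sin q-\frac{g}{l}\cos q,\quad b=\frac{\mu}{l}\left|\ddot\xi(t)\cos q+g\sin q\right|. $$ A solution is an absolutely continuous function $t\mapsto(q(t),p(t))$ on an interval or segment $I$ such that $(\dot q(t),\dot p(t))\in\Phi(q(t),p(t),t)$ for almost every $t\in I$. For every initial condition at $t_0$, a solution exists on $[t_0,\infty)$ and is unique forward in time, which gives meaning to ''the solution''. *)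

(* Defs.v *)
From HB Require Import structures.
From mathcomp Require Import all_boot all_order all_algebra.
From mathcomp Require Import all_classical all_reals all_analysis.
Import Order.TTheory GRing.Theory Num.Theory.
Import numFieldNormedType.Exports.

Set Implicit Arguments.
Unset Strict Implicit.
Unset Printing Implicit Defensive.

Local Open Scope classical_set_scope.
Local Open Scope ring_scope.

(* Right-hand side of the system. Division being total in MathComp, this has a
   junk value at p = 0; [pendulum_limit_values] never evaluates it there. *)
Definition pendulum_rhs (R : realType) (l g mu : R) (xi : R -> R) (t : R)
    (x : R^o * R^o) : R^o * R^o :=
  let: (q, p) := x in
  (p,
   derive1n 2 xi t / l * sin q
   - mu / l * `|derive1n 2 xi t * cos q - l * p ^+ 2 + g * sin q| * (p / `|p|)
   - g / l * cos q).

Definition pendulum_limit_values (R : realType) (l g mu : R) (xi : R -> R)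
    (t : R) (x : R^o * R^o) : set (R^o * R^o) :=
  cluster (pendulum_rhs l g mu xi t @ within [set y | y.2 != 0] (nbhs x)).

Definition pendulum_Phi (R : realType) (l g mu : R) (xi : R -> R)
    (q p t : R) : set (R^o * R^o) :=
  smallest [set A : set (R^o * R^o) | closed A /\ convex_set A]
    (pendulum_limit_values l g mu xi t (q, p)).

Definition abs_continuous_segment (R : realType) (a b : R) (f : R -> R) :=
  forall e : R, 0 < e -> exists2 d : R, 0 < d &
    forall (n : nat) (u v : 'I_n -> R),
      (forall i, a <= u i /\ u i <= v i /\ v i <= b) ->
      trivIset setT (fun i => `]u i, v i[%classic) ->
      \sum_(i < n) (v i - u i) < d ->
      \sum_(i < n) `|f (v i) - f (u i)| < e.

(* On an interval that is not a segment, absolute continuity is understood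
   locally, that is, on every segment contained in the interval. *)
Definition abs_continuous_on (R : realType) (I : interval R) (f : R -> R) :=
  forall a b : R, a \in I -> b \in I -> abs_continuous_segment a b f.

(* The two-sided derivatives are required at almost every point only, so the
   endpoints of I do not matter. *)
Definition pendulum_solution (R : realType) (l g mu : R) (xi : R -> R)
    (I : interval R) (q p : R -> R) :=
  [/\ abs_continuous_on I q,
      abs_continuous_on I p &
      {ae @lebesgue_measure R, forall t : R, t \in I ->
        [/\ derivable q t 1, derivable p t 1 &
            pendulum_Phi l g mu xi (q t) (p t) t (derive1 q t, derive1 p t)]}].

(* Main.v *)
Require Import Defs.
From HB Require Import structures.
From mathcomp Require Import all_boot all_order all_algebra.
From mathcomp Require Import all_classical all_reals all_analysis.
From mathcomp Require Import measurable_realfun ring lra.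
Import Order.TTheory GRing.Theory Num.Theory.
Import numFieldNormedType.Exports.

Local Open Scope classical_set_scope.
Local Open Scope ring_scope.

(** Shooting from the initial conditions [(x, 0)], [0 <= x <= pi]. The hypothesis
    [mu * `|xi''| < g] says that at a horizontal position gravity beats friction,
    so a trajectory that reaches [q = 0] with [p <= 0], or [q = pi] with [p >= 0],
    strictly leaves the strip at once. Hence the initial positions whose trajectory
    leaves through [0] first, resp. through [pi] first, form two disjoint open sets,
    the first containing [0] and the second [pi]; by connectedness some [x] is in
    neither, and its trajectory never leaves.

    Uniqueness and continuous dependence come from the fact that friction is
    dissipative: the field is one-sided Lipschitz, so the squared distance of two
    solutions satisfies a Gronwall inequality, for absolutely continuous functions
    and almost everywhere derivatives. The same inequality, with an error term, makes
    the polygons of an Euler scheme, implicit in the sign of the velocity, a Cauchy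
    sequence; the limit solves the inclusion classically where [p != 0], and at the
    density points of [p = 0] because there [p' = 0]. *)

Set Implicit Arguments.
Unset Strict Implicit.
Unset Printing Implicit Defensive.

(** The conclusion asks for a solution and for the trapping of every solution with the same initial
    data, where solutions are merely absolutely continuous; so monotonicity is derived by covering
    the exceptional set instead of integrating. The dynamics is abstracted into a drift [a] and a
    friction bound [c], with an error [e] that admits polygons ([e > 0]) as well as true solutions
    ([e = 0]): a single comparison estimate then serves convergence, uniqueness and continuous
    dependence. The friction bound is quadratic in the velocity, so Lipschitz constants require a
    prior bound on [p]; it is available because friction never increases the speed. Uniform limits
    do not keep derivatives, hence it is increments that pass to the limit. The slope of [p] is
    always at least [a - c], and at most [a - c] while [p > 0]; the reflection of [(q, p)] into its
    opposite supplies every mirrored statement. *)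

(** The step hypothesis at the supremum [s] of the points up to which [P] holds would carry [P] past
    [s], unless [s = b]. At [x = a] the premise is vacuous, which provides the base case. The lemma
    stands in for compactness and connectedness of the segment. *)
Lemma real_induction (R : realType) (a b : R) (P : R -> Prop) :
  (forall x, a <= x <= b -> (forall w, a <= w < x -> P w) ->
    exists2 r, 0 < r & forall v, x <= v <= b -> v < x + r -> P v) ->
  forall x, a <= x <= b -> P x.
Proof.
move=> step x0 /andP[ax0 x0b]; apply/not_notP => nPx0.
pose S := [set x | a <= x <= b /\ forall w, a <= w <= x -> P w].
have ab : a <= b by exact: le_trans x0b.
have Sa : S a.
  split; first by rewrite lexx.
  have [||r r0 Pr w /andP[aw wa]] := step a; first by rewrite lexx.
    by move=> w /andP[aw wa]; move: (le_lt_trans aw wa); rewrite ltxx.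
  apply: Pr; first by rewrite aw (le_trans wa).
  by rewrite (le_lt_trans wa)// ltrDl.
have hS : has_sup S by split; [exists a|exists b => y [/andP[]]].
set s := sup S.
have as_ : a <= s by apply: ub_le_sup => //; exact: hS.2.
have sb : s <= b by apply: ge_sup; [exists a|move=> y [/andP[]]].
have Plt w : a <= w < s -> P w.
  move=> /andP[aw ws].
  have [y Sy wy] : exists2 y, S y & w < y.
    have : 0 < s - w by rewrite subr_gt0.
    by move=> /(sup_adherent)/(_ hS)[y Sy]; rewrite opprB addrC subrK; exists y.
  by apply: Sy.2; rewrite aw ltW.
have [|r r0 Pr] := step s _ Plt; first by rewrite as_.
have Psv v : s <= v <= b -> v < s + r -> S v.
  move=> /andP[sv vb] vr; split; first by rewrite (le_trans as_).
  move=> w /andP[aw wv]; have [ws|sw] := ltP w s; first by apply: Plt; rewrite aw.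
  by apply: Pr; [rewrite sw (le_trans wv)|exact: le_lt_trans vr].
have [sb'|bs] := ltP s b; last first.
  have eqsb : s = b by apply/eqP; rewrite eq_le sb bs.
  have : S s by apply: Psv; rewrite ?lexx// ltrDl.
  by move=> [_ /(_ x0)]; rewrite ax0 eqsb x0b => /(_ isT).
have : S (Num.min b (s + r / 2)).
  apply: Psv; first by rewrite ge_min lexx le_min sb lerDl divr_ge0 ?(ltW r0).
  by rewrite gt_min ltrD2l ltr_pdivrMr// mulr_natr mulr2n ltrDl r0 orbT.
move=> /(ub_le_sup hS.2); rewrite -/s ge_min => /orP[|].
  by rewrite leNgt sb'.
by rewrite gerDl leNgt divr_gt0.
Qed.

(** * Calculus of absolutely continuous functions *)

Section absolute_continuity.
Context {R : realType}.
Implicit Types (f g : R -> R) (a b : R).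

Lemma abs_continuous_sub (a b a' b' : R) f : a <= a' -> b' <= b ->
  abs_continuous_segment a b f -> abs_continuous_segment a' b' f.
Proof.
move=> aa bb acf e e0; have [d d0 D] := acf e e0; exists d => // n u v uv.
by apply: D => i; have [? [? ?]] := uv i; split; [exact: le_trans aa _|
  split => //; exact: le_trans bb].
Qed.

Lemma lipschitz_abs_continuous (a b M : R) f :
  (forall x y, a <= x -> x <= y -> y <= b -> `|f y - f x| <= M * (y - x)) ->
  abs_continuous_segment a b f.
Proof.
move=> Lf e e0; exists (e / (`|M| + 1)).
  by rewrite divr_gt0// ltr_wpDl.
move=> n u v uv _; rewrite ltr_pdivlMr ?ltr_wpDl// => sd.
apply: le_lt_trans sd; rewrite mulr_suml; apply: ler_sum => i _.
have [au [uvi vb]] := uv i.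
apply: (le_trans (Lf _ _ au uvi vb)); rewrite mulrC ler_wpM2l ?subr_ge0//.
by rewrite (le_trans (ler_norm M))// lerDl.
Qed.

Lemma abs_continuous_unif (a b : R) f : abs_continuous_segment a b f ->
  forall e, 0 < e -> exists2 d, 0 < d & forall x y, a <= x -> x <= y ->
    y <= b -> y - x < d -> `|f y - f x| < e.
Proof.
move=> acf e e0; have [d d0 D] := acf e e0; exists d => // x y ax xy yb xyd.
have := D 1%N (fun=> x) (fun=> y); rewrite !big_ord1; apply => //.
by apply/trivIsetP => i j _ _; rewrite !ord1.
Qed.

Lemma abs_continuous_bounded (a b : R) f : abs_continuous_segment a b f ->
  exists M, forall x, a <= x <= b -> `|f x| <= M.
Proof.
move=> acf; have [ab|ba] := leP a b; last first.
  by exists 0 => x /andP[/le_trans h /h]; rewrite leNgt ba.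
have [d d0 D] := abs_continuous_unif acf ltr01.
suff /(_ b) : forall x, a <= x <= b ->
    exists M, forall y, a <= y <= x -> `|f y| <= M by apply; rewrite ab lexx.
apply: real_induction => x /andP[ax xb] IH; exists (d / 2); first by rewrite divr_gt0.
(* A bound is already known up to [w]. As [v < x + d / 2], the points of [[w, v]] are within
   [5 d / 6 < d] of [w], so [f] changes there by less than 1. *)
pose w := Num.max a (x - d / 3).
have wx : w <= x by rewrite ge_max ax gerBl divr_ge0// ltW.
have aw : a <= w by rewrite le_max lexx.
have xw : x - w <= d / 3 by rewrite lerBlDr -lerBlDl le_max lexx orbT.
have [M HM] : exists M, forall y, a <= y <= w -> `|f y| <= M.
  have [ax'|xa] := ltP a x.
    by apply: IH; rewrite aw gt_max ax' gtrBl divr_gt0.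
  have -> : w = a by apply/eqP; rewrite eq_le aw andbT (le_trans wx).
  by exists `|f a| => y; rewrite andbC -eq_le => /eqP ->.
move=> v /andP[xv vb] vx; exists (M + 1) => y /andP[ay yv].
have [yw|wy] := leP y w.
  by rewrite (le_trans (HM y _)) ?ay ?lerDl.
have : `|f y - f w| < 1.
  apply: D => //; [exact: ltW|exact: le_trans vb|].
  by lra.
have : `|f w| <= M by apply: HM; rewrite aw lexx.
have := ler_normD (f y - f w) (f w); rewrite subrK; lra.
Qed.

Lemma abs_continuousD (a b : R) f g : abs_continuous_segment a b f ->
  abs_continuous_segment a b g -> abs_continuous_segment a b (f \+ g).
Proof.
move=> acf acg e e0.
have [d1 d10 D1] := acf (e / 2) (divr_gt0 e0 (ltr0Sn _ 1)).
have [d2 d20 D2] := acg (e / 2) (divr_gt0 e0 (ltr0Sn _ 1)).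
exists (Num.min d1 d2); first by rewrite lt_min d10.
move=> n u v uv tr; rewrite lt_min => /andP[h1 h2].
apply: (@le_lt_trans _ _ (\sum_(i < n) `|f (v i) - f (u i)|
    + \sum_(i < n) `|g (v i) - g (u i)|)).
  rewrite -big_split/=; apply: ler_sum => i _.
  by rewrite opprD addrACA ler_normD.
by have := D1 n u v uv tr h1; have := D2 n u v uv tr h2; lra.
Qed.

Lemma abs_continuousN (a b : R) f : abs_continuous_segment a b f ->
  abs_continuous_segment a b (\- f).
Proof.
move=> acf e e0; have [d d0 D] := acf e e0; exists d => // n u v uv tr sd.
by under eq_bigr do rewrite -opprD normrN; exact: D.
Qed.

Lemma abs_continuousM (a b : R) f g : abs_continuous_segment a b f ->
  abs_continuous_segment a b g -> abs_continuous_segment a b (f \* g).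
Proof.
move=> acf acg e e0.
have [M HM] := abs_continuous_bounded acf; have [N HN] := abs_continuous_bounded acg.
pose C := `|M| + `|N| + 1.
have C0 : 0 < C by rewrite ltr_wpDl ?addr_ge0.
have eC : 0 < e / 2 / C by rewrite !divr_gt0.
have [d1 d10 D1] := acf _ eC; have [d2 d20 D2] := acg _ eC.
exists (Num.min d1 d2); first by rewrite lt_min d10.
move=> n u v uv tr; rewrite lt_min => /andP[h1 h2].
apply: (@le_lt_trans _ _ (C * (\sum_(i < n) `|f (v i) - f (u i)|)
    + C * (\sum_(i < n) `|g (v i) - g (u i)|))).
  rewrite -mulrDr -big_split/= mulr_sumr; apply: ler_sum => i _.
  have [au [uvi vb]] := uv i.
  have fv : `|f (v i)| <= C.
    rewrite (le_trans (HM _ _)) ?vb ?(le_trans au)//.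
    by rewrite (le_trans (ler_norm M))// /C -addrA lerDl addr_ge0.
  have gu : `|g (u i)| <= C.
    rewrite (le_trans (HN _ _)) ?au ?(le_trans uvi)//.
    by rewrite (le_trans (ler_norm N))// /C addrAC lerDr addr_ge0.
  have -> : f (v i) * g (v i) - f (u i) * g (u i) =
    g (u i) * (f (v i) - f (u i)) + f (v i) * (g (v i) - g (u i)) by ring.
  by rewrite (le_trans (ler_normD _ _))// !normrM mulrDr lerD// ler_wpM2r.
have := D1 n u v uv tr h1; have := D2 n u v uv tr h2.
by rewrite !ltr_pdivlMr//; lra.
Qed.

End absolute_continuity.

(** * Derivatives as first-order bounds on increments *)

Section derivative_increments.
Context {R : realType}.
Implicit Types (f : R -> R) (x d : R).

Lemma is_derive_increment f x d : is_derive x (1 : R) f d ->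
  forall e, 0 < e -> exists2 r, 0 < r &
    forall y, `|y - x| < r -> `|f y - f x - d * (y - x)| <= e * `|y - x|.
Proof.
move=> [df <-] e e0; move/cvg_ex: df => [k df].
have -> : 'D_1 f x = k by apply: cvg_lim.
move/cvgrPdist_lt/(_ _ e0)/nbhs_ballP: df => [r /= r0 B]; exists r => // y yr.
have [->|yx] := eqVneq y x; first by rewrite !subrr mulr0 subr0 normr0 mulr0.
have yx0 : y - x != 0 by rewrite subr_eq0.
have := B (y - x); rewrite /ball/= sub0r normrN => /(_ yr yx0).
rewrite -[(y - x) *: 1]/((y - x) * 1) mulr1 subrK -[_ *: _]/((y - x)^-1 * _).
move=> /ltW h; have -> : f y - f x - k * (y - x) =
  - (k - (y - x)^-1 * (f y - f x)) * (y - x) by field.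
by rewrite normrM normrN ler_wpM2r.
Qed.

Lemma increment_is_derive f x d :
  (forall e, 0 < e -> exists2 r, 0 < r &
    forall y, `|y - x| < r -> `|f y - f x - d * (y - x)| <= e * `|y - x|) ->
  is_derive x (1 : R) f d.
Proof.
move=> H.
suff cv : (h^-1 *: (f (h *: 1 + x) - f x)) @[h --> 0^'] --> d.
  by apply: DeriveDef; [apply/cvg_ex; exists d|exact: cvg_lim].
apply/cvgrPdist_le => e e0; have [r r0 B] := H e e0.
apply/nbhs_ballP; exists r => //= h; rewrite /ball/= sub0r normrN => hr h0.
have := B (h + x); rewrite addrK => /(_ hr).
rewrite -[h *: 1]/(h * 1) mulr1 -[_ *: _]/(h^-1 * _) => le.
have -> : d - h^-1 * (f (h + x) - f x) =
  - (f (h + x) - f x - d * h) * h^-1 by field.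
by rewrite normrM normrN normfV ler_pdivrMr ?normr_gt0.
Qed.

Lemma is_derive_derive1 f x d : is_derive x (1 : R) f d -> derive1 f x = d.
Proof. by rewrite derive1E => -[]. Qed.

Lemma derivable_is_derive1 f x : derivable f x 1 ->
  is_derive x (1 : R) f (derive1 f x).
Proof. by rewrite derive1E => /derivableP. Qed.

End derivative_increments.

(** * Monotonicity from almost everywhere derivatives *)

Section growth.
Context {R : realType}.
Local Notation mu := (@lebesgue_measure R).
Implicit Types (a b : R) (f : R -> R).

Lemma negligible_open_cover (N : set R) (d : R) : mu.-negligible N -> 0 < d ->
  exists U : set R, [/\ open U, N `<=` U & (mu U < d%:E)%E].
Proof.
move=> [N' [mN' N'0 NN']] d0.
have N'oo : (mu N' < +oo)%E by rewrite N'0 ltry.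
have [U [oU NU mUd]] := lebesgue_regularity_outer mN' N'oo d0.
exists U; split => //; first exact: subset_trans NU.
have mU : measurable U by exact: open_measurable.
have mUN : measurable (U `\` N') by exact: measurableD.
have UN : (mu ((U `\` N') `|` N') <= mu (U `\` N') + mu N')%E by exact: measureU2.
rewrite (le_lt_trans _ mUd)// -[leRHS]adde0 -[X in (_ + X)%E]N'0.
rewrite (le_trans _ UN)// le_measure ?inE//; first exact: measurableU.
by rewrite setDKU.
Qed.

Lemma sum_disjoint_itv_le n (u v : 'I_n -> R) (U : set R) : measurable U ->
  (forall i, u i <= v i) -> (forall i, `]u i, v i[%classic `<=` U) ->
  trivIset setT (fun i => `]u i, v i[%classic) ->
  ((\sum_(i < n) (v i - u i))%:E <= mu U)%E.
Proof.
move=> mU uv sU tr.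
have mF i : measurable (`]u i, v i[%classic : set R) by [].
have mI i : lebesgue_measure `]u i, v i[%classic = (v i - u i)%:E.
  rewrite lebesgue_measure_itv/= lte_fin; case: ltP => [_|vu]; first by [].
  by have -> : v i = u i; [apply/eqP; rewrite eq_le vu uv|rewrite subrr].
rewrite -sumEFin -(eq_bigr _ (fun i _ => mI i)).
rewrite -(measure_bigsetU_ord mu predT mF tr) le_measure ?inE//.
  exact: bigsetU_measurable.
by elim/big_ind: _ => // A B AU BU x [/AU|/BU].
Qed.

(** The exceptional set is covered by an open [U] of measure below the modulus [d] of absolute
    continuity. Away from it [f] grows at slope at most [e]; the remaining growth takes place on
    finitely many disjoint intervals inside [U], where it totals less than [e]. *)
Lemma abs_continuous_nonincreasing a b f : a <= b ->
  abs_continuous_segment a b f ->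
  {ae (@lebesgue_measure R), forall t, a < t < b ->
    derivable f t 1 /\ derive1 f t <= 0} ->
  f b <= f a.
Proof.
move=> ab acf aef.
suff H e : 0 < e -> f b <= f a + e * (b - a + 1).
  apply/ler_addgt0Pr => e e0; have c0 : 0 < b - a + 1 by lra.
  by rewrite (le_trans (H (e / (b - a + 1)) _)) ?divr_gt0// divfK// gt_eqF.
move=> e0; have [d d0 D] := acf e e0.
(* The endpoints join the exceptional set, since the hypothesis concerns the open interval only. *)
have Nn : (@lebesgue_measure R).-negligible
    ([set t | ~ (a < t < b -> derivable f t 1 /\ derive1 f t <= 0)]
      `|` ([set a] `|` [set b])).
  apply: negligibleU => //; apply: negligibleU; apply/negligibleP => //;
  exact: lebesgue_measure_set1.
have [U [oU NU mUd]] := negligible_open_cover Nn d0.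
(* A certificate for [[a, x]]: an ordered list of intervals inside [U] that pays for all growth of
   [f] beyond slope [e]. Real induction extends it up to [b]. *)
pose P x := exists n (u v : nat -> R),
  [/\ forall i, (i < n)%N -> [/\ a <= u i, u i <= v i, v i <= x &
         `]u i, v i[%classic `<=` U],
      forall i j, (i < j < n)%N -> v i <= u j &
      f x - f a <= e * (x - a) + \sum_(i < n) `|f (v i) - f (u i)|].
have Pgood x y : P x -> x <= y -> f y - f x <= e * (y - x) -> P y.
  move=> [n [u [v [H1 H2 H3]]]] xy fxy; exists n, u, v; split=> //.
    by move=> i /H1[? ? vx ?]; split=> //; exact: le_trans xy.
  by rewrite -(subrK (f x) (f y)) -addrA (le_trans (lerD fxy H3))//; lra.
have Pbad x y : P x -> a <= x -> x <= y -> `]x, y[%classic `<=` U -> P y.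
  move=> [n [u [v [H1 H2 H3]]]] ax xy xyU.
  exists n.+1, (fun i => if (i < n)%N then u i else x),
    (fun i => if (i < n)%N then v i else y); split.
  - move=> i; rewrite ltnS leq_eqVlt; case: ifPn => [lin _|lin].
      by have [? ? ? ?] := H1 _ lin; split=> //; exact: le_trans xy.
    by split.
  - move=> i j /andP[ij]; rewrite ltnS leq_eqVlt => /orP[/eqP jn|jn].
      by rewrite -jn ij ltnn; rewrite jn in ij; have [] := H1 _ ij.
    by rewrite jn (ltn_trans ij jn); apply: H2; rewrite ij.
  - rewrite big_ord_recr/= ltnn.
    under eq_bigr => i _ do rewrite ltn_ord.
    have : f y - f x <= `|f y - f x| by exact: ler_norm.
    have : e * (x - a) <= e * (y - a) by rewrite ler_wpM2l ?(ltW e0)// lerD2r.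
    by move: H3; lra.
have Pa : P a.
  exists 0%N, (fun=> 0), (fun=> 0); split=> //; last by rewrite big_ord0 !subrr mulr0 addr0.
have Pb : P b.
  apply: (real_induction (P := P) (a := a) (b := b)) => //; last by rewrite ab lexx.
  move=> x /andP[ax xb] IH.
  (* Certificates are known only to the left of [x], so one is extended in a single jump from a
     nearby [w] across [x] to [v]; if [x = a], the start is [a] itself. *)
  suff [r r0 Hr] : exists2 r, 0 < r & forall w v, a <= w -> x - r < w <= x ->
      x <= v <= b -> v < x + r -> P w -> P v.
    exists r => // v xvb vr.
    have [ax'|xa] := ltP a x; last first.
      by apply: (Hr a) => //; rewrite ax andbT; lra.
    pose w := Num.max a (x - r / 2).
    have aw : a <= w by rewrite le_max lexx.
    have wx : w < x by rewrite gt_max ax'/= gtrBl divr_gt0.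
    have xrw : x - r < w by rewrite lt_max; apply/orP; right; lra.
    apply: (Hr w) => //; first by rewrite xrw ltW.
    by apply: IH; rewrite aw wx.
  have [xU|xU] := pselect (U x).
    have [r /= r0 B] : nbhs_ball x U by apply/nbhs_ballP; exact: open_nbhs_nbhs.
    exists r => // w v aw /andP[rw wx] /andP[xv vb] vr Pw.
    apply: (Pbad w) => //; first exact: le_trans xv.
    move=> z /=; rewrite in_itv/= => /andP[wz zv]; apply: B.
    by rewrite /ball/= ltr_distlC; apply/andP; split; lra.
  have [axb dfx dfx0] : [/\ a < x < b, derivable f x 1 & derive1 f x <= 0].
    have xN : a < x < b -> derivable f x 1 /\ derive1 f x <= 0.
      by apply/not_notP => xN; apply: xU; apply: NU; left.
    have axb : a < x < b.
      rewrite !lt_neqAle ax xb !andbT; apply/andP; split; apply/eqP => xE.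
        by apply: xU; apply: NU; right; left; rewrite /= xE.
      by apply: xU; apply: NU; right; right; rewrite /= xE.
    by have [] := xN axb; split.
  (* At a good point the first-order bounds on [[w, x]] and [[x, v]] add up to a growth of at most
     [e * (v - w)], the linear term being nonpositive. *)
  have [r r0 Hr] := is_derive_increment (derivable_is_derive1 dfx) e0.
  exists r => // w v aw /andP[rw wx] /andP[xv vb] vr Pw.
  apply: (Pgood w) => //; first exact: le_trans xv.
  have : `|f v - f x - derive1 f x * (v - x)| <= e * (v - x).
    by have := Hr v; rewrite ger0_norm ?subr_ge0//; apply; lra.
  have : `|f w - f x - derive1 f x * (w - x)| <= e * (x - w).
    have := Hr w; rewrite (distrC w x) ger0_norm ?subr_ge0//; apply; lra.
  rewrite !ler_norml => /andP[h1 _] /andP[_ h2].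
  have : derive1 f x * (v - w) <= 0 by rewrite mulr_le0_ge0// subr_ge0 (le_trans wx).
  by lra.
have [n [u [v [H1 H2 H3]]]] := Pb.
have tr : trivIset setT (fun i : 'I_n => `]u i, v i[%classic).
  apply/trivIsetP => i j _ _; wlog: i j / (i < j)%N => [H ij|ij _].
    have [ij'|ji|eij] := ltngtP i j; first exact: H.
      by rewrite setIC; apply: H => //; rewrite eq_sym.
    by move: ij; rewrite -val_eqE/= eij eqxx.
  apply/seteqP; split=> // z [/=]; rewrite !in_itv/= => /andP[_ zv] /andP[uz _].
  have : v i <= u j by apply: H2; rewrite ij/=.
  by lra.
have mU : measurable U by exact: open_measurable.
have := D n (fun i => u i) (fun i => v i).
have uv (i : 'I_n) : a <= u i /\ u i <= v i /\ v i <= b by have [] := H1 i (ltn_ord i).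
move=> /(_ uv tr).
have sd : \sum_(i < n) (v i - u i) < d.
  rewrite -lte_fin (le_lt_trans _ mUd)//; apply: sum_disjoint_itv_le => //.
    by move=> i; have [_ []] := uv i.
  by move=> i; have [] := H1 i (ltn_ord i).
by move=> /(_ sd); lra.
Qed.

End growth.

(** * Gronwall inequality *)

Section gronwall.
Context {R : realType}.
Local Notation mu := (@lebesgue_measure R).
Implicit Types (a b : R) (f : R -> R).

Lemma ae_lebesgueS (P Q : R -> Prop) : (forall t, P t -> Q t) ->
  {ae mu, forall t, P t} -> {ae mu, forall t, Q t}.
Proof. by move=> PQ; apply: negligibleS => t /= nQ /PQ. Qed.

Lemma ae_lebesgueI (P Q : R -> Prop) :
  {ae mu, forall t, P t} -> {ae mu, forall t, Q t} ->
  {ae mu, forall t, P t /\ Q t}.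
Proof.
move=> aP aQ; apply: negligibleS (negligibleU aP aQ) => t /= /not_andP[]; by [left|right].
Qed.

Lemma abs_continuous_growth a b k f : a <= b -> abs_continuous_segment a b f ->
  {ae mu, forall t, a < t < b -> exists2 d, is_derive t (1 : R) f d & d <= k} ->
  f b - f a <= k * (b - a).
Proof.
move=> ab acf aef; suff : (f \+ (fun t => - k * t)) b <= (f \+ (fun t => - k * t)) a.
  by rewrite /=; lra.
apply: abs_continuous_nonincreasing => //.
  apply: abs_continuousD => //; apply: (@lipschitz_abs_continuous _ _ _ `|k|).
  by move=> x y _ xy _; rewrite -mulrBr normrM normrN (ger0_norm (x := y - x))// subr_ge0.
apply: ae_lebesgueS aef => t H /H[d fd dk].
have D : is_derive t (1 : R) (f \+ (fun t => - k * t)) (d - k).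
  by apply: is_derive_eq; rewrite -[_ *: _]/(- k * 1) mulr1.
by split; [case: D|rewrite (is_derive_derive1 D) subr_le0].
Qed.

Lemma abs_continuous_growth_ge a b k f : a <= b -> abs_continuous_segment a b f ->
  {ae mu, forall t, a < t < b -> exists2 d, is_derive t (1 : R) f d & k <= d} ->
  k * (b - a) <= f b - f a.
Proof.
move=> ab acf aef.
suff : (\- f) b - (\- f) a <= - k * (b - a) by rewrite /=; lra.
apply: abs_continuous_growth => //; first exact: abs_continuousN.
apply: ae_lebesgueS aef => t H /H[d fd kd]; exists (- d); last by rewrite lerN2.
exact: is_deriveN.
Qed.

Lemma expR_lipschitz_abs_continuous a b L : 0 <= L ->
  abs_continuous_segment a b (fun t => expR (- L * t)).
Proof.
move=> L0; apply: (@lipschitz_abs_continuous _ _ _ (L * expR (- L * a))).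
move=> x y ax xy yb.
have -> : - L * y = - L * x + (- L * (y - x)) by ring.
rewrite expRD -[X in _ - X]mulr1 -mulrBr normrM (ger0_norm (expR_ge0 _)).
have e1 : expR (- L * (y - x)) <= 1.
  by rewrite -expR0 ler_expR mulNr oppr_le0 mulr_ge0// subr_ge0.
rewrite ler0_norm ?subr_le0// opprB mulrC mulrAC ler_pM ?expR_ge0 ?subr_ge0//.
  by have := expR_ge1Dx (- L * (y - x)); lra.
by rewrite ler_expR !mulNr lerN2 ler_wpM2l.
Qed.

(** The shift by [E / L] makes the differential inequality homogeneous, and the integrating factor
    [expR (- L * t)] then makes the shifted function nonincreasing. *)
Lemma abs_continuous_gronwall a b L E u : a <= b -> 0 < L ->
  abs_continuous_segment a b u ->
  {ae mu, forall t, a < t < b ->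
    exists2 d, is_derive t (1 : R) u d & d <= L * u t + E} ->
  u b + E / L <= (u a + E / L) * expR (L * (b - a)).
Proof.
move=> ab L0 acu aeu.
pose v : R -> R := (u \+ cst (E / L)) \* (fun t => expR (- L * t)).
have vba : v b <= v a.
  apply: abs_continuous_nonincreasing => //.
    apply: abs_continuousM; last exact/expR_lipschitz_abs_continuous/ltW.
    apply: abs_continuousD => //; apply: (@lipschitz_abs_continuous _ _ _ 0).
    by move=> x y _ _ _; rewrite subrr normr0 mul0r.
  apply: ae_lebesgueS aeu => t H /H[d ud dL].
  have D1 : is_derive t (1 : R) (u \+ cst (E / L)) d.
    by apply: is_derive_eq; rewrite addr0.
  have D2 : is_derive t (1 : R) (fun t => expR (- L * t)) (- L * expR (- L * t)).
    by apply: is_derive_eq; rewrite -[(- L)%:A]/(- L * 1) mulr1 mulrC.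
  have D : is_derive t (1 : R) v
      ((u t + E / L) * (- L * expR (- L * t)) + expR (- L * t) * d).
    exact: is_deriveM.
  split; first by case: D.
  rewrite (is_derive_derive1 D).
  have -> : (u t + E / L) * (- L * expR (- L * t)) + expR (- L * t) * d =
     expR (- L * t) * (d - (L * u t + E)) by field; exact: lt0r_neq0.
  by rewrite mulr_ge0_le0 ?expR_ge0// subr_le0.
have -> : expR (L * (b - a)) = expR (- L * a) * expR (L * b).
  by rewrite -expRD; congr expR; ring.
have -> : u b + E / L = (u b + E / L) * expR (- L * b) * expR (L * b).
  by rewrite -mulrA -expRD mulNr addNr expR0 mulr1.
by rewrite mulrA ler_wpM2r ?expR_ge0.
Qed.

End gronwall.

(** * Dissipativity of dry friction and comparison of solutions *)

Section dry_friction.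
Context {R : realType}.
Local Notation mu := (@lebesgue_measure R).

(* [d] is, up to [e], an acceleration [a - w] where [w] is an admissible friction
   force: [`|w| <= c], with [w = c * Num.sg p] as soon as [p != 0]. *)
Definition friction_incl (a c e p d : R) := exists w z,
  [/\ `|z - p| <= e, `|w| <= c + e, (c - e) * `|z| <= z * w & `|d - a + w| <= e].

Definition approx_solution (a : R -> R -> R) (c : R -> R -> R -> R) (e s T : R)
    (q p : R -> R) :=
  [/\ abs_continuous_segment s T q, abs_continuous_segment s T p &
    {ae mu, forall t, s < t < T -> exists dq dp,
      [/\ is_derive t (1 : R) q dq, is_derive t (1 : R) p dp, `|dq - p t| <= e &
        friction_incl (a (q t) t) (c (q t) (p t) t) e (p t) dp]}].

(** Friction is monotone in the velocity: up to errors, [(z1 - z2) * (w1 - w2)] is at least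
    [(c1 - c2)] times the difference of the absolute values of [z1] and [z2], by expanding the
    product. It therefore enters the estimate only through the variation of [c], without any
    continuity in the sign of [p]. *)
Lemma friction_incl_one_sided (a1 a2 c1 c2 e p1 p2 d1 d2 C P : R) : 0 <= e <= 1 ->
  0 <= c1 <= C -> 0 <= c2 <= C -> `|p1| <= P -> `|p2| <= P ->
  friction_incl a1 c1 e p1 d1 -> friction_incl a2 c2 e p2 d2 ->
  (p1 - p2) * (d1 - d2) <= `|p1 - p2| * `|a1 - a2| + `|c1 - c2| * `|p1 - p2|
    + e * (8 * (C + P + 1)).
Proof.
move=> /andP[e0 e1] /andP[c10 c1C] /andP[c20 c2C] p1P p2P.
move=> [w1 [z1 [zp1 wc1 zw1 dr1]]] [w2 [z2 [zp2 wc2 zw2 dr2]]].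
have le_norm (x y B D : R) : `|x| <= B -> `|y| <= D -> x * y <= B * D.
  move=> xB yD; have : `|x * y| <= B * D by rewrite normrM ler_pM.
  exact: le_trans (ler_norm _).
have P0 : 0 <= P by rewrite (le_trans _ p1P).
have C0 : 0 <= C by lra.
have z1P : `|z1| <= P + 1.
  by have := ler_normD (z1 - p1) p1; rewrite subrK; lra.
have z2P : `|z2| <= P + 1.
  by have := ler_normD (z2 - p2) p2; rewrite subrK; lra.
(* The errors are [4 * P * e] here, [4 * e * (C + 1)] in [h2], [2 * C * e] in [h7] and
   [4 * e * (P + 1)] from [h8] and [h9]; together at most [e * (8 * (C + P + 1))]. *)
have h1 : (p1 - p2) * ((d1 - a1 + w1) - (d2 - a2 + w2)) <= (2 * P) * (2 * e).
  apply: le_norm; rewrite (le_trans (ler_normB _ _))//; lra.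
have h2 : ((z1 - p1) - (z2 - p2)) * (w1 - w2) <= (2 * e) * (2 * (C + 1)).
  apply: le_norm; rewrite (le_trans (ler_normB _ _))//; lra.
have h3 : z1 * w2 <= `|z1| * (c2 + e) by exact: le_norm.
have h4 : z2 * w1 <= `|z2| * (c1 + e) by exact: le_norm.
have h5 : - (c1 - c2) * (`|z1| - `|z2|) <= `|c1 - c2| * (`|p1 - p2| + 2 * e).
  apply: le_norm; first by rewrite normrN.
  rewrite (le_trans (ler_dist_dist _ _))//.
  have -> : z1 - z2 = (p1 - p2) + ((z1 - p1) - (z2 - p2)) by ring.
  rewrite (le_trans (ler_normD _ _))// lerD2l (le_trans (ler_normB _ _))//; lra.
have h6 : (p1 - p2) * (a1 - a2) <= `|p1 - p2| * `|a1 - a2| by exact: le_norm.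
have h7 : `|c1 - c2| * (2 * e) <= C * (2 * e).
  by rewrite ler_wpM2r ?ler_norml; clear - e0 c10 c1C c20 c2C; lra.
have h10 : 0 <= e * C by rewrite mulr_ge0.
have h8 : e * `|z1| <= e * (P + 1) by rewrite ler_wpM2l.
have h9 : e * `|z2| <= e * (P + 1) by rewrite ler_wpM2l.
lra.
Qed.

(** Local in the velocity, because the pendulum friction is quadratic in [p]. Regularity in time is
    included since an Euler step freezes [t] at a node. *)
Definition lipschitz_field (a : R -> R -> R) (c : R -> R -> R -> R) (s T P K : R) :=
  1 <= K /\ forall q q' p p' t t', `|p| <= P -> `|p'| <= P ->
    s <= t <= T -> s <= t' <= T ->
    [/\ `|a q t - a q' t'| <= K * (`|q - q'| + `|t - t'|),
        `|c q p t - c q' p' t'| <= K * (`|q - q'| + `|p - p'| + `|t - t'|) &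
        0 <= c q p t <= K].

Lemma approx_solution_sub a c e s T s' T' q p : s <= s' -> T' <= T ->
  approx_solution a c e s T q p -> approx_solution a c e s' T' q p.
Proof.
move=> ss TT [qac pac ae]; split; [exact: abs_continuous_sub qac|
  exact: abs_continuous_sub pac|].
apply: ae_lebesgueS ae => t H /andP[st tT]; apply: H.
by rewrite (le_lt_trans ss)// (lt_le_trans tT).
Qed.

Lemma approx_solution_comparison a c e s T P K q1 p1 q2 p2 :
  lipschitz_field a c s T P K -> 0 <= e <= 1 ->
  approx_solution a c e s T q1 p1 -> approx_solution a c e s T q2 p2 ->
  (forall t, s <= t <= T -> `|p1 t| <= P) ->
  (forall t, s <= t <= T -> `|p2 t| <= P) ->
  forall t, s <= t <= T ->
  (q1 t - q2 t) ^+ 2 + (p1 t - p2 t) ^+ 2 <=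
  ((q1 s - q2 s) ^+ 2 + (p1 s - p2 s) ^+ 2 + e * (18 * (K + P + 1)))
    * expR ((3 + 4 * K) * (T - s)).
Proof.
move=> [K1 aclip] /andP[e0 e1] sol1 sol2 p1P p2P t /andP[st tT].
have [q1ac p1ac ae1] := approx_solution_sub (lexx s) tT sol1.
have [q2ac p2ac ae2] := approx_solution_sub (lexx s) tT sol2.
have P0 : 0 <= P by rewrite (le_trans _ (p1P s _)) ?lexx ?(le_trans st).
pose Q := q1 \+ (\- q2); pose W := p1 \+ (\- p2).
have Qac : abs_continuous_segment s t Q.
  by apply: abs_continuousD => //; exact: abs_continuousN.
have Wac : abs_continuous_segment s t W.
  by apply: abs_continuousD => //; exact: abs_continuousN.
pose u := (Q \* Q) \+ (W \* W).
have uac : abs_continuous_segment s t u.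
  by apply: abs_continuousD; exact: abs_continuousM.
(* With [X] and [Y] the distances in position and velocity, the derivative of [u] is at most [2XY +
   4eX + 4KXY + 2KY^2 + 16e(K + P + 1)]. The bounds [2XY <= X^2 + Y^2] and [4eX <= 2X^2 + 2e]
   produce [3 + 4 * K] and [18]. *)
pose L := 3 + 4 * K; pose E := e * (18 * (K + P + 1)).
have L1 : 1 <= L by rewrite /L; lra.
have L0 : 0 < L by lra.
have E0 : 0 <= E by rewrite mulr_ge0//; lra.
have main : u t + E / L <= (u s + E / L) * expR (L * (t - s)).
  apply: abs_continuous_gronwall => //.
  apply: ae_lebesgueS (ae_lebesgueI ae1 ae2) => x [H1 H2] /andP[sx xt].
  have {H1} [|dq1 [dp1 [Dq1 Dp1 eq1 F1]]] := H1; first by rewrite sx.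
  have {H2} [|dq2 [dp2 [Dq2 Dp2 eq2 F2]]] := H2; first by rewrite sx.
  have DQ : is_derive x (1 : R) Q (dq1 - dq2) by exact: is_deriveB.
  have DW : is_derive x (1 : R) W (dp1 - dp2) by exact: is_deriveB.
  exists (2 * (Q x * (dq1 - dq2)) + 2 * (W x * (dp1 - dp2))).
    have -> : 2 * (Q x * (dq1 - dq2)) + 2 * (W x * (dp1 - dp2)) =
      (Q x * (dq1 - dq2) + Q x * (dq1 - dq2)) +
      (W x * (dp1 - dp2) + W x * (dp1 - dp2)) by ring.
    have DQQ : is_derive x (1 : R) (Q \* Q) _ := is_deriveM DQ DQ.
    have DWW : is_derive x (1 : R) (W \* W) _ := is_deriveM DW DW.
    exact: is_deriveD.
  have sxT : s <= x <= T by rewrite !ltW// (lt_le_trans xt).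
  have [ha hc /andP[c10 c1K]] :=
    aclip (q1 x) (q2 x) (p1 x) (p2 x) x x (p1P x sxT) (p2P x sxT) sxT sxT.
  have [_ _ c2K] :=
    aclip (q2 x) (q2 x) (p2 x) (p2 x) x x (p2P x sxT) (p2P x sxT) sxT sxT.
  have h1 : W x * (dp1 - dp2) <= _ := friction_incl_one_sided (C := K) (P := P) _ _
    _ _ _ F1 F2.
  rewrite subrr normr0 !addr0 in ha; rewrite subrr normr0 !addr0 in hc.
  have {h1} h1 : W x * (dp1 - dp2) <= `|W x| * (K * `|Q x|) +
      K * (`|Q x| + `|W x|) * `|W x| + e * (8 * (K + P + 1)).
    rewrite (le_trans (h1 _ _ _ _ _))//; [by rewrite e0|by rewrite c10|exact: p1P|exact: p2P|].
    rewrite lerD2r; apply: lerD; [exact: ler_wpM2l|exact: ler_wpM2r].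
  have h2 : Q x * (dq1 - dq2) <= `|Q x| * (`|W x| + 2 * e).
    rewrite (le_trans (ler_norm _))// normrM ler_wpM2l//.
    have -> : dq1 - dq2 = W x + ((dq1 - p1 x) - (dq2 - p2 x)) by rewrite /W/=; ring.
    by rewrite (le_trans (ler_normD _ _))// lerD2l (le_trans (ler_normB _ _))//; lra.
  rewrite [X in L * X](_ : _ = `|Q x| * `|Q x| + `|W x| * `|W x|); last first.
    by rewrite /u/= -!expr2 !real_normK ?num_real.
  set X := `|Q x| in h1 h2 *; set Y := `|W x| in h1 h2 *.
  have X0 : 0 <= X by exact: normr_ge0.
  have Y0 : 0 <= Y by exact: normr_ge0.
  have XY : 2 * (X * Y) <= X * X + Y * Y by have := sqr_ge0 (X - Y); clear; lra.
  have KXY : K * (2 * (X * Y)) <= K * (X * X + Y * Y).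
    by rewrite ler_wpM2l// (le_trans ler01).
  have eX : 0 <= e * (X - 1) ^+ 2 by rewrite mulr_ge0// sqr_ge0.
  have eX2 : e * (X * X) <= X * X by rewrite ler_piMl// mulr_ge0.
  have KX2 : 0 <= K * (X * X) by rewrite !mulr_ge0// (le_trans ler01).
  have eKP : 0 <= e * (K + P) by rewrite mulr_ge0// addr_ge0// (le_trans ler01).
  have YY0 : 0 <= Y * Y by rewrite mulr_ge0.
  by rewrite /L /E; clear - h1 h2 KXY XY eX eX2 KX2 eKP YY0 e0; lra.
have uE y : u y = (q1 y - q2 y) ^+ 2 + (p1 y - p2 y) ^+ 2 by rewrite /u/= -!expr2.
rewrite -!uE -/E -/L.
have EL0 : 0 <= E / L by rewrite divr_ge0// ltW.
have ELE : E / L <= E by rewrite ler_pdivrMr// ler_peMr.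
rewrite (@le_trans _ _ (u t + E / L)) ?lerDl//.
rewrite (le_trans main)// ler_pM ?expR_ge0//.
- by rewrite addr_ge0// uE addr_ge0 ?sqr_ge0.
- by rewrite lerD2l.
- by rewrite ler_expR ler_wpM2l ?(ltW L0)// lerD2r.
Qed.

End dry_friction.

(** * Piecewise linear interpolation on a uniform grid *)

Section polygon.
Context {R : realType}.
Implicit Types (y : nat -> R) (h s t : R).

Definition polygon s h y t : R :=
  let k := Num.truncn ((t - s) / h) in
  y k + (t - (s + k%:R * h)) * ((y k.+1 - y k) / h).

(** The formula of cell [k] persists at its right end, although the truncation already returns
    [k.+1] there: this agreement is the continuity of the polygon. *)
Lemma polygonE s h y k t : 0 < h -> s + k%:R * h <= t <= s + k.+1%:R * h ->
  polygon s h y t = y k + (t - (s + k%:R * h)) * ((y k.+1 - y k) / h).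
Proof.
move=> h0 /andP[kt]; rewrite le_eqVlt => /orP[/eqP ->|tk].
  rewrite /polygon addrAC subrr add0r mulfK ?gt_eqF// natrK subrr mul0r addr0.
  by rewrite -natr1; field; exact: lt0r_neq0.
rewrite /polygon; suff -> : Num.truncn ((t - s) / h) = k by [].
by apply: truncn_def; rewrite ler_pdivlMr// ltr_pdivrMr//; apply/andP; split; lra.
Qed.

Lemma polygon_nat s h y k : 0 < h -> polygon s h y (s + k%:R * h) = y k.
Proof.
move=> h0; rewrite (@polygonE s h y k) ?subrr ?mul0r ?addr0//.
by rewrite lexx lerD2l ler_wpM2r ?ltW// ltr_nat.
Qed.

Lemma polygon_cell s h t : 0 < h -> s <= t ->
  exists k, s + k%:R * h <= t < s + k.+1%:R * h.
Proof.
move=> h0 st; exists (Num.truncn ((t - s) / h)).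
have : 0 <= (t - s) / h by rewrite divr_ge0 ?subr_ge0// ltW.
move=> /truncn_itv/andP[]; rewrite ler_pdivlMr// ltr_pdivrMr// => ? ?.
by apply/andP; split; lra.
Qed.

Lemma polygon_lipschitz s h y M n : 0 < h ->
  (forall k, (k < n)%N -> `|y k.+1 - y k| <= M * h) ->
  forall u v, s <= u -> u <= v -> v <= s + n%:R * h ->
    `|polygon s h y v - polygon s h y u| <= M * (v - u).
Proof.
move=> h0; elim: n => [_|n IH yM] u v su uv.
  rewrite mul0r addr0 => vs.
  have -> : u = v by apply/eqP; rewrite eq_le uv (le_trans vs).
  by rewrite !subrr normr0 mulr0.
move=> vn.
have cell u' v' : s + n%:R * h <= u' -> u' <= v' -> v' <= s + n.+1%:R * h ->
    `|polygon s h y v' - polygon s h y u'| <= M * (v' - u').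
  move=> nu uv' vn'; rewrite !(@polygonE s h y n)//; last 2 first.
    by rewrite nu (le_trans uv').
    by rewrite vn' (le_trans nu).
  rewrite (_ : _ - _ = (y n.+1 - y n) / h * (v' - u')); last by ring.
  rewrite normrM (ger0_norm (x := v' - u')) ?subr_ge0// ler_wpM2r ?subr_ge0//.
  by rewrite normrM normfV (gtr0_norm h0) ler_pdivrMr// yM.
have {}IH := IH (fun k kn => yM k (ltnW kn)).
have [vn'|/ltW nv] := leP v (s + n%:R * h); first exact: IH.
have [nu|/ltW un] := leP (s + n%:R * h) u; first exact: cell.
rewrite (_ : _ - _ = (polygon s h y v - polygon s h y (s + n%:R * h)) +
  (polygon s h y (s + n%:R * h) - polygon s h y u)); last by ring.
rewrite (le_trans (ler_normD _ _))//.
have := cell _ _ (lexx _) nv vn; have := IH _ _ su un (lexx _); lra.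
Qed.

Lemma polygon_derive s h y k t : 0 < h -> s + k%:R * h < t < s + k.+1%:R * h ->
  is_derive t (1 : R) (polygon s h y) ((y k.+1 - y k) / h).
Proof.
move=> h0 /andP[kt tk]; apply: increment_is_derive => e e0.
exists (Num.min (t - (s + k%:R * h)) (s + k.+1%:R * h - t)).
  by rewrite lt_min !subr_gt0 kt.
move=> z; rewrite lt_min ltr_distlC => /andP[/andP[h1 h2]].
rewrite ltr_distlC => /andP[h3 h4].
rewrite !(@polygonE s h y k)// ?(ltW kt) ?(ltW tk)//; last by apply/andP; split; lra.
rewrite [X in `|X|](_ : _ = 0); last by ring.
by rewrite normr0 mulr_ge0 ?(ltW e0).
Qed.

Lemma polygon_bounded s h y k t P : 0 < h -> s + k%:R * h <= t <= s + k.+1%:R * h ->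
  `|y k| <= P -> `|y k.+1| <= P -> `|polygon s h y t| <= P.
Proof.
move=> h0 /andP[kt tk] yP yP1; rewrite (@polygonE s h y k) ?kt//.
pose r := (t - (s + k%:R * h)) / h.
have r0 : 0 <= r by rewrite divr_ge0 ?subr_ge0// ltW.
have r1 : 0 <= 1 - r.
  by rewrite subr_ge0 ler_pdivrMr//; move: tk; rewrite -natr1; lra.
rewrite [X in `|X|](_ : _ = (1 - r) * y k + r * y k.+1); last by rewrite /r; ring.
clearbody r; rewrite (le_trans (ler_normD _ _))// !normrM (ger0_norm r0) (ger0_norm r1).
have := ler_wpM2l r0 yP1; have := ler_wpM2l r1 yP; lra.
Qed.

End polygon.

(** * Euler scheme, implicit in the sign of the velocity *)

Section euler_scheme.
Context {R : realType}.
Local Notation mu := (@lebesgue_measure R).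

(** Soft thresholding, the resolvent of dry friction: it solves [y = x - w] for a [w] in [[-r, r]]
    equal to [r] times the sign of [y] when [y != 0]. *)
Definition shrink (r x : R) : R :=
  if r < x then x - r else if x < - r then x + r else 0.

Lemma shrinkP (r x : R) : 0 <= r ->
  [/\ `|x - shrink r x| <= r, r * `|shrink r x| <= shrink r x * (x - shrink r x) &
      `|shrink r x| <= `|x|].
Proof.
move=> r0; rewrite /shrink; case: ltP => [rx|xr].
  have xr0 : 0 <= x - r by lra.
  have x0 : 0 <= x by lra.
  by rewrite subKr !ger0_norm//; split; lra.
case: ltP => [xr'|rx].
  have xr0 : x + r <= 0 by lra.
  have x0 : x <= 0 by lra.
  rewrite opprD addrA subrr add0r normrN (ger0_norm r0) !ler0_norm//; split; lra.
by rewrite subr0 !normr0 mulr0 mul0r; split => //; rewrite ler_norml xr rx.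
Qed.

Variables (a : R -> R -> R) (c : R -> R -> R -> R) (s q0 p0 A : R).
Hypothesis aA : forall q t, s <= t -> `|a q t| <= A.
Hypothesis c_ge0 : forall q p t, 0 <= c q p t.
Hypothesis acP : forall P T, exists K, lipschitz_field a c s T P K.

(* Explicit Euler step except for the sign of the velocity in the friction term,
   which is that of the new velocity. *)
Fixpoint euler (h : R) (k : nat) : R * R :=
  if k is k'.+1 then
    let: (q, p) := euler h k' in
    let t := s + k'%:R * h in
    (q + h * p, shrink (h * c q p t) (p + h * a q t))
  else (q0, p0).

Definition euler_q h k := (euler h k).1.
Definition euler_p h k := (euler h k).2.

Lemma euler_qS h k : euler_q h k.+1 - euler_q h k = h * euler_p h k.
Proof. by rewrite /euler_q /euler_p/=; case: (euler h k) => q p /=; ring. Qed.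

(** Here [w] is the friction force realized by the step; it obeys Coulomb's law exactly for the new
    velocity, with the coefficient frozen at the old node. *)
Lemma euler_pS h k : 0 < h ->
  let t := s + k%:R * h in
  let w := a (euler_q h k) t - (euler_p h k.+1 - euler_p h k) / h in
  `|w| <= c (euler_q h k) (euler_p h k) t /\
  c (euler_q h k) (euler_p h k) t * `|euler_p h k.+1| <= euler_p h k.+1 * w.
Proof.
move=> h0 t w; rewrite /w {w} /euler_q /euler_p/=; case: (euler h k) => q p /=.
have hc0 : 0 <= h * c q p t by rewrite mulr_ge0// ltW.
have [] := shrinkP (p + h * a q t) hc0; rewrite -/t; set y := shrink _ _.
move=> h1 h2 _; have -> : a q t - (y - p) / h = (p + h * a q t - y) / h.
  by field; exact: lt0r_neq0.
rewrite normrM normfV (gtr0_norm h0) ler_pdivrMr// (mulrC (c q p t)) h1; split => //.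
by rewrite mulrA ler_pdivlMr//; lra.
Qed.

(** Thresholding only decreases the speed, so the drift alone bounds the velocity. No bound on [c]
    enters, which avoids a circle: the constants for [c] depend on a velocity bound. *)
Lemma euler_p_le h k : 0 < h -> `|euler_p h k| <= `|p0| + A * (k%:R * h).
Proof.
move=> h0; elim: k => [|k]; first by rewrite mul0r mulr0 addr0.
rewrite /euler_p/=; case: (euler h k) => q p /= IH; set t := s + _.
have hc0 : 0 <= h * c q p t by rewrite mulr_ge0// ltW.
have [_ _ h1] := shrinkP (p + h * a q t) hc0.
rewrite (le_trans h1)// (le_trans (ler_normD _ _))// normrM (gtr0_norm h0).
have : h * `|a q t| <= h * A.
  rewrite ler_wpM2l ?(ltW h0)// aA// /t lerDl mulr_ge0// ltW//.
by rewrite -natr1; lra.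
Qed.

Lemma euler_approx_solution T : s <= T -> exists C, 0 <= C /\
  forall h, 0 < h <= 1 ->
    approx_solution a c (C * h) s T (polygon s h (euler_q h)) (polygon s h (euler_p h))
    /\ forall t, s <= t <= T -> `|polygon s h (euler_p h) t| <= `|p0| + A * (T - s + 1).
Proof.
move=> sT; have A0 : 0 <= A by rewrite (le_trans _ (aA 0 (lexx s))).
(* The extra 1 in [T - s + 1] makes room for the node ending the last cell, which may exceed [T] by
   up to [h <= 1]. *)
set P := _ + A * _.
have P0 : 0 <= P by rewrite addr_ge0// mulr_ge0//; lra.
have [K [K1 acK]] := acP P T.
(* Within a cell the position moves by [P * h], the velocity by [(A + K) * h] and time by [h], so
   the field varies by [K] times their sum; [C * h] dominates this and the velocity displacement. *)
pose C := (K + 1) * (P + A + K + 1).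
have C0 : 0 <= C by rewrite mulr_ge0//; lra.
have AKC : A + K <= C.
  have : 0 <= K * (P + A + K + 1) by rewrite mulr_ge0; lra.
  by rewrite /C; lra.
exists C; split => // h /andP[h0 h1].
have hC0 : 0 <= C * h by rewrite mulr_ge0// ltW.
have stk k : s <= s + k%:R * h by rewrite lerDl mulr_ge0// ltW.
have pkP k : s + k%:R * h <= T -> `|euler_p h k| <= P.
  move=> kT; rewrite (le_trans (euler_p_le _ h0))// lerD2l ler_wpM2l//; lra.
have pkP1 k : s + k%:R * h <= T -> `|euler_p h k.+1| <= P.
  move=> kT; rewrite (le_trans (euler_p_le _ h0))// lerD2l ler_wpM2l//.
  by rewrite -natr1; lra.
have dp k : s + k%:R * h <= T -> `|euler_p h k.+1 - euler_p h k| <= (A + K) * h.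
  move=> kT; have := (euler_pS k h0).1; set w := _ - _ => wc.
  have kT' : s <= s + k%:R * h <= T by rewrite stk.
  have [_ _ /andP[_ cK]] := acK (euler_q h k) (euler_q h k) _ _ _ _ (pkP k kT) (pkP k kT) kT' kT'.
  have -> : euler_p h k.+1 - euler_p h k = (a (euler_q h k) (s + k%:R * h) - w) * h.
    by rewrite /w; field; exact: lt0r_neq0.
  rewrite normrM (gtr0_norm h0) ler_wpM2r ?(ltW h0)// (le_trans (ler_normB _ _))//.
  by rewrite lerD// ?aA// (le_trans wc).
have dq k : s + k%:R * h <= T -> `|euler_q h k.+1 - euler_q h k| <= P * h.
  move=> kT; rewrite euler_qS normrM (gtr0_norm h0) mulrC ler_wpM2r ?(ltW h0)//.
  exact: pkP.
have pP t : s <= t <= T -> `|polygon s h (euler_p h) t| <= P.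
  move=> /andP[st tT]; have [k /andP[kt tk]] := polygon_cell h0 st.
  have kT : s + k%:R * h <= T by exact: le_trans tT.
  by apply: (polygon_bounded (k := k)); rewrite ?kt ?(ltW tk)//; [exact: pkP|exact: pkP1].
split => //.
have [N NT] : exists N, T <= s + N%:R * h /\ forall k, (k < N)%N -> s + k%:R * h <= T.
  have [k /andP[kT Tk]] := polygon_cell h0 sT.
  exists k.+1; split; first exact: ltW.
  move=> j jk; rewrite (le_trans _ kT)// lerD2l ler_wpM2r ?(ltW h0)// ler_nat.
  by rewrite -ltnS.
have acpoly M y : (forall k, s + k%:R * h <= T -> `|y k.+1 - y k| <= M * h) ->
    abs_continuous_segment s T (polygon s h y).
  move=> yM; apply: (@lipschitz_abs_continuous _ _ _ M) => u v su uv vT.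
  apply: (polygon_lipschitz (n := N)) => //; last exact: le_trans NT.1.
  by move=> k /NT.2; exact: yM.
split; [exact: acpoly dq|exact: acpoly dp|].
(* The countably many nodes, where the slope of the polygon may jump, are discarded. *)
have nodes : {ae mu, forall t, forall k, t <> s + k%:R * h}.
  have : mu.-negligible (\bigcup_k [set s + k%:R * h]).
    by apply: negligible_bigcup => k; apply/negligibleP => //; exact: lebesgue_measure_set1.
  by apply: negligibleS => t /= /existsNP[k /contrapT ->]; exists k.
apply: ae_lebesgueS nodes => t tn /andP[st tT].
have [k /andP[]] := polygon_cell h0 (ltW st).
rewrite le_eqVlt => /orP[/eqP tE|kt tk]; first by have := tn k; rewrite -tE.
have kT : s + k%:R * h <= T by rewrite ltW// (lt_trans kt).
have cell : s + k%:R * h <= t <= s + k.+1%:R * h by rewrite !ltW.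
have kT' : s <= s + k%:R * h <= T by rewrite stk.
have stT : s <= t <= T by rewrite !ltW.
have tkh : 0 <= t - (s + k%:R * h) <= h.
  by move: cell; rewrite -natr1 => /andP[? ?]; apply/andP; split; lra.
have near y M : 0 <= M -> `|y k.+1 - y k| <= M * h ->
    `|y k - polygon s h y t| <= M * h /\ `|y k.+1 - polygon s h y t| <= M * h.
  move=> M0 yM; rewrite (polygonE y h0 cell).
  pose r := (t - (s + k%:R * h)) / h.
  have r0 : 0 <= r by rewrite divr_ge0 ?(ltW h0)//; lra.
  have r1 : 0 <= 1 - r by rewrite subr_ge0 ler_pdivrMr//; lra.
  rewrite [X in `|y k - X|](_ : _ = y k + r * (y k.+1 - y k)); last by rewrite /r; ring.
  rewrite [X in `|y k.+1 - X|](_ : _ = y k + r * (y k.+1 - y k)); last by rewrite /r; ring.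
  clearbody r.
  have -> : y k - (y k + r * (y k.+1 - y k)) = - r * (y k.+1 - y k) by ring.
  have -> : y k.+1 - (y k + r * (y k.+1 - y k)) = (1 - r) * (y k.+1 - y k) by ring.
  rewrite !normrM normrN (ger0_norm r0) (ger0_norm r1).
  by split; rewrite (le_trans _ yM)// ler_piMl//; clear - q0 p0 aA c_ge0 acP r0 r1; lra.
have [|nq _] := near (euler_q h) P P0; first exact: dq.
have [||np1 np2] := near (euler_p h) (A + K); [by lra|exact: dp|].
exists ((euler_q h k.+1 - euler_q h k) / h), ((euler_p h k.+1 - euler_p h k) / h).
have AKhC : (A + K) * h <= C * h by rewrite ler_wpM2r// ltW.
split.
- by apply: polygon_derive => //; rewrite kt.
- by apply: polygon_derive => //; rewrite kt.
- by rewrite euler_qS [h * _]mulrC mulfK ?gt_eqF// (le_trans np1).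
have [wc cw] := euler_pS k h0; set w := a _ _ - _ in wc cw.
(* The velocity that governs the sign of friction is that of the next node, within [(A + K) * h] of
   the polygon; this is what the slack [z] of [friction_incl] is for. *)
exists w, (euler_p h k.+1).
have [ha hc _] := acK (euler_q h k) (polygon s h (euler_q h) t) _ _ _ _
  (pkP k kT) (pP t stT) kT' stT.
have tk' : `|s + k%:R * h - t| <= h.
  by have [? ?] := andP tkh; rewrite distrC ger0_norm.
have KC : K * (P * h + (A + K) * h + h) <= C * h.
  have -> : C * h = K * (P * h + (A + K) * h + h) + (P + A + K + 1) * h by rewrite /C; ring.
  by rewrite lerDl mulr_ge0 ?(ltW h0)//; clear - q0 p0 aA c_ge0 acP P0 A0 K1; lra.
have {}hc : `|c (euler_q h k) (euler_p h k) (s + k%:R * h) -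
    c (polygon s h (euler_q h) t) (polygon s h (euler_p h) t) t| <= C * h.
  by rewrite (le_trans hc)// (le_trans _ KC)// ler_wpM2l ?lerD// (le_trans ler01).
have {}ha : `|a (euler_q h k) (s + k%:R * h) - a (polygon s h (euler_q h) t) t| <= C * h.
  rewrite (le_trans ha)// (le_trans _ KC)// ler_wpM2l ?(le_trans ler01)//.
  have AKh : 0 <= (A + K) * h by rewrite mulr_ge0 ?addr_ge0 ?(ltW h0)// (le_trans ler01).
  by clear - q0 p0 aA c_ge0 acP AKh nq tk'; lra.
move: hc; rewrite ler_norml => /andP[hc1 hc2].
split.
- exact: le_trans AKhC.
- by rewrite (le_trans wc)//; clear - q0 p0 aA c_ge0 acP hc2; lra.
- by rewrite (le_trans _ cw)// ler_wpM2r//; clear - q0 p0 aA c_ge0 acP hc1 hc2 hC0; lra.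
- by rewrite (_ : _ + w = a (euler_q h k) (s + k%:R * h) -
    a (polygon s h (euler_q h) t) t)// /w; ring.
Qed.

End euler_scheme.

(** * Uniform limits of approximate solutions *)

Section limit_of_approximations.
Context {R : realType}.
Local Notation mu := (@lebesgue_measure R).
Implicit Types (f : nat -> R -> R) (s T : R).

Lemma uniformly_cauchy_limit f s :
  (forall T d, 0 < d -> exists N, forall n m, (N <= n)%N -> (N <= m)%N ->
    forall t, s <= t <= T -> `|f n t - f m t| <= d) ->
  exists g, forall T d, 0 < d -> exists N, forall n, (N <= n)%N ->
    forall t, s <= t <= T -> `|f n t - g t| <= d.
Proof.
move=> fC; exists (fun t => lim (f ^~ t @ \oo)) => T d d0.
have [N HN] := fC T d d0; exists N => n Nn t tT.
have cvgf : f m t @[m --> \oo] --> lim (f ^~ t @ \oo).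
  suff : cvg (f ^~ t @ \oo) by [].
  apply/cauchy_cvgP/cauchy_exP => e e0.
  have [M HM] := fC T _ (divr_gt0 e0 (ltr0Sn R 1)); exists (f M t), M => // m /= Mm.
  by rewrite /ball/= (le_lt_trans (HM _ _ _ _ _ tT))//; lra.
apply/ler_addgt0Pr => e e0.
move/cvgrPdist_le/(_ _ e0): cvgf => [M _ HM].
have := HM (maxn M N) (leq_maxl _ _); have := HN _ _ Nn (leq_maxr M N) _ tT.
move=> h1 h2; rewrite (_ : f n t - _ = (f n t - f (maxn M N) t) +
  - (lim (f ^~ t @ \oo) - f (maxn M N) t)); last by ring.
by rewrite (le_trans (ler_normD _ _))// normrN lerD.
Qed.

Lemma friction_incl_le_error (a c e e' p d : R) : e <= e' ->
  friction_incl a c e p d -> friction_incl a c e' p d.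
Proof.
move=> ee [w [z [h1 h2 h3 h4]]].
exists w, z; split; [exact: le_trans ee| |  |exact: le_trans ee].
  by rewrite (le_trans h2)// lerD2l.
by rewrite (le_trans _ h3)// ler_wpM2r// lerD2l lerN2.
Qed.

Lemma approx_solution_le (a : R -> R -> R) c e e' s T q p : e <= e' ->
  approx_solution a c e s T q p -> approx_solution a c e' s T q p.
Proof.
move=> ee [qac pac ae]; split => //; apply: ae_lebesgueS ae => t H /H.
move=> [dq [dp [Dq Dp le incl]]]; exists dq, dp; split => //.
  exact: le_trans ee.
exact: friction_incl_le_error incl.
Qed.

(** No derivative of [q] or [p] is mentioned, since uniform convergence does not preserve them;
    [limit_solution_exact] recovers the inclusion. *)
Definition limit_solution (a : R -> R -> R) c s (q p : R -> R) :=
  forall T e, 0 < e -> exists Q P, approx_solution a c e s T Q P /\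
    forall t, s <= t <= T -> `|Q t - q t| <= e /\ `|P t - p t| <= e.

Lemma exists_small_step (x e : R) : 0 <= x -> 0 < e ->
  exists N, forall n, (N <= n)%N -> x * n.+1%:R^-1 <= e.
Proof.
move=> x0 e0; exists (Num.truncn (x / e)) => n Nn.
rewrite ler_pdivrMr ?ltr0n// mulrC -ler_pdivrMr//.
have /truncn_itv/andP[_ /ltW h] : 0 <= x / e by rewrite divr_ge0// ltW.
by rewrite (le_trans h)// ler_nat ltnS.
Qed.

Lemma limit_solution_exists (a : R -> R -> R) c s q0 p0 A :
  (forall q t, s <= t -> `|a q t| <= A) -> (forall q p t, 0 <= c q p t) ->
  (forall P T, exists K, lipschitz_field a c s T P K) ->
  exists q p, [/\ limit_solution a c s q p, q s = q0, p s = p0 &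
    forall t, s <= t -> `|p t| <= `|p0| + A * (t - s + 1)].
Proof.
move=> aA c0 acP; pose h n : R := n.+1%:R^-1.
pose Q n := polygon s (h n) (euler_q a c s q0 p0 (h n)).
pose P n := polygon s (h n) (euler_p a c s q0 p0 (h n)).
have h0 n : 0 < h n by rewrite invr_gt0 ltr0n.
have h1 n : h n <= 1 by rewrite invf_le1 ?ltr0n// ler1n.
have Qs n : Q n s = q0.
  by have := polygon_nat s (euler_q a c s q0 p0 (h n)) 0 (h0 n); rewrite mul0r addr0.
have Ps n : P n s = p0.
  by have := polygon_nat s (euler_p a c s q0 p0 (h n)) 0 (h0 n); rewrite mul0r addr0.
have approx T e : s <= T -> 0 < e -> exists N, forall n, (N <= n)%N ->
    approx_solution a c e s T (Q n) (P n).
  move=> sT e0; have [C [C0 HC]] := euler_approx_solution q0 p0 aA c0 acP sT.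
  have [N HN] := exists_small_step C0 e0; exists N => n Nn.
  by apply: approx_solution_le (HN n Nn) _; apply: (HC _ _).1; rewrite h0 h1.
have Pbnd n t : s <= t -> `|P n t| <= `|p0| + A * (t - s + 1).
  move=> st; have [C [C0 HC]] := euler_approx_solution q0 p0 aA c0 acP st.
  by apply: (HC (h n) _).2; rewrite ?h0 ?h1 ?st ?lexx.
have A0 : 0 <= A by rewrite (le_trans _ (aA 0 s _)).
have cauchy T d : 0 < d -> exists N, forall n m, (N <= n)%N -> (N <= m)%N ->
    forall t, s <= t <= T -> `|Q n t - Q m t| <= d /\ `|P n t - P m t| <= d.
  move=> d0; have [sT|Ts] := leP s T; last first.
    by exists 0%N => n m _ _ t /andP[/le_trans st /st]; rewrite leNgt Ts.
  set B := `|p0| + A * (T - s + 1).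
  have B0 : 0 <= B by rewrite addr_ge0// mulr_ge0//; lra.
  have [K acK] := acP B T; have K1 := acK.1.
  pose D := 18 * (K + B + 1) * expR ((3 + 4 * K) * (T - s)).
  have D0 : 0 < D by rewrite mulr_gt0 ?expR_gt0//; lra.
  (* Two polygons share their initial data, so the comparison bounds their squared distance by
     [e * D], hence by [d ^+ 2]. *)
  pose e := Num.min 1 (d ^+ 2 / D).
  have e0 : 0 < e by rewrite lt_min ltr01/= divr_gt0// exprn_gt0.
  have [N HN] := approx T e sT e0; exists N => n m Nn Nm t tT.
  have PB k u : s <= u <= T -> `|P k u| <= B.
    move=> /andP[su uT]; rewrite (le_trans (Pbnd k u su))// lerD2l ler_wpM2l//; lra.
  have e01 : 0 <= e <= 1 by rewrite ltW//= ge_min lexx.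
  have := approx_solution_comparison acK e01 (HN n Nn) (HN m Nm) (PB n) (PB m) tT.
  rewrite !Qs !Ps !subrr expr0n/= !add0r -mulrA -/D => le_eD.
  have {le_eD} le_d : (Q n t - Q m t) ^+ 2 + (P n t - P m t) ^+ 2 <= d ^+ 2.
    by rewrite (le_trans le_eD)// -ler_pdivlMr// ge_min lexx orbT.
  have d0' := ltW d0.
  have := sqr_ge0 (Q n t - Q m t); have := sqr_ge0 (P n t - P m t) => hP hQ.
  split; rewrite -(@ler_pXn2r _ 2)// ?nnegrE// real_normK ?num_real//; lra.
have [q Hq] : exists q, forall T d, 0 < d -> exists N, forall n, (N <= n)%N ->
    forall t, s <= t <= T -> `|Q n t - q t| <= d.
  apply: uniformly_cauchy_limit => T d d0; have [N HN] := cauchy T d d0.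
  by exists N => n m Nn Nm t tT; exact: (HN n m Nn Nm t tT).1.
have [p Hp] : exists p, forall T d, 0 < d -> exists N, forall n, (N <= n)%N ->
    forall t, s <= t <= T -> `|P n t - p t| <= d.
  apply: uniformly_cauchy_limit => T d d0; have [N HN] := cauchy T d d0.
  by exists N => n m Nn Nm t tT; exact: (HN n m Nn Nm t tT).2.
exists q, p; split.
- move=> T e e0.
  (* [T] may precede [s], whereas the Euler estimate requires a final time after [s]. *)
  have [N1 H1] := approx (Num.max s T) e (ltac:(by rewrite le_max lexx)) e0.
  have [N2 H2] := Hq T e e0; have [N3 H3] := Hp T e e0.
  pose n := maxn N1 (maxn N2 N3).
  exists (Q n), (P n); split.
    apply: (approx_solution_sub (s := s) (T := Num.max s T)) => //.
      by rewrite le_max lexx orbT.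
    by apply: H1; rewrite leq_maxl.
  move=> t tT; split; [apply: H2 => //|apply: H3 => //].
    by rewrite /n !leq_max leqnn !orbT.
  by rewrite /n !leq_max leqnn !orbT.
- apply/eqP; rewrite -subr_eq0 -normr_le0; apply/ler_addgt0Pr => e e0.
  have [N /(_ N (leqnn _) s)] := Hq s e e0; rewrite lexx Qs distrC add0r; exact.
- apply/eqP; rewrite -subr_eq0 -normr_le0; apply/ler_addgt0Pr => e e0.
  have [N /(_ N (leqnn _) s)] := Hp s e e0; rewrite lexx Ps distrC add0r; exact.
- move=> t st; apply/ler_addgt0Pr => e e0.
  have [N /(_ N (leqnn _) t)] := Hp t e e0; rewrite st lexx => /(_ isT).
  have := Pbnd N t st; have := ler_normB (P N t) (P N t - p t).
  by rewrite subKr; lra.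
Qed.

End limit_of_approximations.

(** * Derivative on the zero set of a Lipschitz function *)

Section zeros_of_lipschitz_functions.
Context {R : realType}.
Local Notation mu := lebesgue_measure.

Lemma lebesgue_measure_hole (Z : set R) (t r y d : R) : measurable Z ->
  0 < d -> 0 < r -> ball y d `<=` ball t r -> Z `&` ball y d = set0 ->
  (mu (Z `&` ball t r) + (2 * d)%:E <= (2 * r)%:E)%E.
Proof.
move=> mZ d0 r0 sub Z0.
have mB x e : measurable (ball x e : set R) by exact: measurable_ball.
have muB (x e : R) : 0 < e -> mu (ball x e) = (2 * e)%:E.
  by move=> e0; rewrite lebesgue_measure_ball ?ltW// mulr_natl.
rewrite -(muB y d d0) -(muB t r r0).
have mZB : measurable (Z `&` ball t r) by exact: measurableI.
have dis : (Z `&` ball t r) `&` ball y d = set0.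
  by rewrite -setIA [ball t r `&` _]setIC setIA Z0 set0I.
have mZBB : measurable ((Z `&` ball t r) `|` ball y d) by exact: measurableU.
rewrite -(measureU mu mZB (mB y d) dis).
rewrite le_measure ?inE//; first exact: measurable_ball.
by move=> z [[]//|/sub].
Qed.

(* At a Lebesgue density point [t] of the zero set, [f y] cannot exceed
   [e * `|y - t|]: the Lipschitz bound would create too large a hole around [y]. *)
Lemma lipschitz_zero_derive (f : R -> R) (M : R) :
  (forall x y, `|f x - f y| <= M * `|x - y|) ->
  {ae mu, forall t, f t = 0 -> is_derive t (1 : R) f 0}.
Proof.
move=> fM; pose N := `|M| + 1.
have N0 : 0 < N by rewrite ltr_wpDl.
have {}fM x y : `|f x - f y| <= N * `|x - y|.
  by rewrite (le_trans (fM x y))// ler_wpM2r// (le_trans (ler_norm M))// lerDl.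
pose Z := [set t | f t = 0].
have mZ : measurable Z.
  apply: closed_measurable; rewrite -openC openE => x /= /eqP fx0.
  apply/nbhs_ballP; exists (`|f x| / N) => [|y]; first by rewrite /= divr_gt0 ?normr_gt0.
  rewrite /ball/= ltr_pdivlMr// => xy fy0; have := fM x y.
  by rewrite fy0 subr0 mulrC; lra.
apply: ae_lebesgueS (lebesgue_density mZ) => t dens ft0.
have {dens} dens h : 0 < h -> exists2 r, 0 < r & forall x, 0 < x < r ->
    ((1 - h)%:E * (2 * x)%:E < mu (Z `&` ball t x))%E.
  move=> h0; have : nbhs 1%:E [set x | ((1 - h)%:E < x)%E].
    apply: open_nbhs_nbhs; split; first exact: open_ereal_gt_ereal.
    by rewrite /= lte_fin gtrBl.
  have -> : 1%:E = (\1_Z t)%:E :> \bar R by rewrite indicE mem_set.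
  move=> /dens /nbhs_ballP[r /= r0 B]; exists r => // x /andP[x0 xr].
  have {}xr : ball 0 r x by rewrite /ball/= sub0r normrN gtr0_norm.
  have muB : mu (ball t x) = (2 * x)%:E.
    by rewrite lebesgue_measure_ball ?ltW// mulr_natl.
  have /= := B x xr x0; rewrite muB inver gt_eqF ?mulr_gt0// lte_pdivlMr ?mulr_gt0//.
apply: increment_is_derive => e e0.
(* If [f y] exceeds the bound, [N * h <= e] forbids zeros within [h] times the distance from [y] to
   [t], and [h <= 1] keeps this hole inside the ball of twice that distance around [t]. *)
pose h := Num.min 1 (e / N).
have h0 : 0 < h by rewrite lt_min ltr01 divr_gt0.
have h1 : h <= 1 by rewrite ge_min lexx.
have hN : N * h <= e by rewrite mulrC -ler_pdivlMr// ge_min lexx orbT.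
(* The hole has radius [h] times the distance, the ball twice the distance: the hole occupies the
   proportion [h / 2] of the ball. *)
have [r r0 Hr] := dens (h / 2) (divr_gt0 h0 (ltr0Sn R 1)).
exists (r / 2); first by rewrite divr_gt0.
move=> y ytr; rewrite ft0 subr0 mul0r subr0 leNgt; apply/negP => fy.
have yt0 : 0 < `|y - t|.
  rewrite normr_gt0 subr_eq0; apply/eqP => yt.
  by move: fy; rewrite yt ft0 subrr !normr0 mulr0 ltxx.
have sub : ball y (h * `|y - t|) `<=` ball t (2 * `|y - t|).
  move=> z; rewrite /ball/= => yz.
  have -> : t - z = (y - z) - (y - t) by ring.
  rewrite (le_lt_trans (ler_normB _ _))//.
  have : h * `|y - t| <= `|y - t| by rewrite ler_piMl.
  by lra.
have hole : Z `&` ball y (h * `|y - t|) = set0.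
  apply/seteqP; split => // z [fz0]; rewrite /ball/= => yz.
  have := fM y z; rewrite fz0 subr0 => fyz.
  have : N * `|y - z| < N * (h * `|y - t|) by rewrite ltr_pM2l.
  have : N * h * `|y - t| <= e * `|y - t| by rewrite ler_wpM2r.
  by rewrite -mulrA; lra.
have := lebesgue_measure_hole mZ (mulr_gt0 h0 yt0) (mulr_gt0 (ltr0Sn R 1) yt0) sub hole.
have : 0 < 2 * `|y - t| < r by lra.
move=> /Hr H1 H2.
have := lt_le_trans (_ : (_ + (2 * (h * `|y - t|))%:E < _ + _)%E) H2.
move=> /(_ ((1 - h / 2)%:E * (2 * (2 * `|y - t|))%:E)%E).
rewrite lteD2rE// => /(_ H1); rewrite -EFinM -EFinD lte_fin; lra.
Qed.

End zeros_of_lipschitz_functions.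

(** * Symmetry under reflection *)

Section reflection.
Context {R : realType}.
Implicit Types (a : R -> R -> R) (c : R -> R -> R -> R) (q p : R -> R).

(** The field satisfied by the opposite of a solution. Applying a one-sided estimate to it gives the
    other side, and exits below become exits above. *)
Definition reflect_drift a (q t : R) := - a (- q) t.
Definition reflect_friction c (q p t : R) : R := c (- q) (- p) t.

Lemma friction_inclN (a c e p d : R) :
  friction_incl a c e p d -> friction_incl (- a) c e (- p) (- d).
Proof.
move=> [w [z [h1 h2 h3 h4]]]; exists (- w), (- z); split.
- by rewrite -opprD normrN.
- by rewrite normrN.
- by rewrite normrN mulrNN.
- by rewrite -!opprD normrN.
Qed.

Lemma approx_solutionN a c e s T q p : approx_solution a c e s T q p ->
  approx_solution (reflect_drift a) (reflect_friction c) e s T (\- q) (\- p).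
Proof.
move=> [qac pac ae]; split; [exact: abs_continuousN|exact: abs_continuousN|].
apply: ae_lebesgueS ae => t H /H[dq [dp [Dq Dp le incl]]].
exists (- dq), (- dp); split; [exact: is_deriveN|exact: is_deriveN| |].
  by rewrite -opprD normrN.
by rewrite /reflect_drift /reflect_friction !opprK; exact: friction_inclN.
Qed.

Lemma limit_solutionN a c s q p : limit_solution a c s q p ->
  limit_solution (reflect_drift a) (reflect_friction c) s (\- q) (\- p).
Proof.
move=> lim T e e0; have [Q [P [sol close]]] := lim T e e0.
exists (\- Q), (\- P); split; first exact: approx_solutionN.
by move=> t /close; rewrite /= -!opprD !normrN.
Qed.

Lemma lipschitz_fieldN a c s T P K : lipschitz_field a c s T P K ->
  lipschitz_field (reflect_drift a) (reflect_friction c) s T P K.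
Proof.
move=> [K1 H]; split => // q q' p p' t t' pP pP' tT tT'.
have [] := H (- q) (- q') (- p) (- p') t t'; rewrite ?normrN//.
by rewrite /reflect_drift /reflect_friction -!opprD !normrN.
Qed.

End reflection.

(** * One-sided increment estimates for limits *)

Section limit_solution_increments.
Context {R : realType}.
Variables (a : R -> R -> R) (c : R -> R -> R -> R) (s : R) (q p : R -> R).
Hypothesis acP : forall P T, exists K, lipschitz_field a c s T P K.
Hypothesis p_bounded : forall T, exists B, forall t, s <= t <= T -> `|p t| <= B.
Hypothesis lim : limit_solution a c s q p.

(** Friction never exceeds [c0], so this side holds for any velocity; the upper bound needs [p0] to
    be safely positive, so that friction opposes the motion at full strength. *)
Lemma friction_incl_ge (a0 c0 e p0 d : R) :
  friction_incl a0 c0 e p0 d -> a0 - c0 - 2 * e <= d.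
Proof.
by move=> [w [z [_ /ler_normlP[_ h2] _ /ler_normlP[h4 _]]]]; lra.
Qed.

Lemma friction_incl_le (a0 c0 e p0 d : R) : e < p0 ->
  friction_incl a0 c0 e p0 d -> d <= a0 - c0 + 2 * e.
Proof.
move=> ep [w [z [/ler_normlP[zp _] _ h3 /ler_normlP[_ h4]]]].
have z0 : 0 < z by lra.
by move: h3; rewrite gtr0_norm// mulrC ler_pM2l//; lra.
Qed.

(* The increments over [[u, v]] of a nearby approximate solution that follows the
   field up to a multiple of [e] pass to the limit [e -> 0]. *)
Lemma limit_solution_net u v (x : R) : s <= u -> u <= v -> 0 < x ->
  exists K, 1 <= K /\ forall e, 0 < e <= x ->
  exists Q P, [/\ approx_solution a c e u v Q P,
    forall t, u <= t <= v -> `|Q t - q t| <= e /\ `|P t - p t| <= e &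
    forall t, u <= t <= v ->
      `|(a (Q t) t - c (Q t) (P t) t) - (a (q t) t - c (q t) (p t) t)| <= 3 * K * e].
Proof.
move=> su uv x0; have [B HB] := p_bounded v.
(* The margin [x] covers the velocities of all approximations. The factor [3 * K] is [K] for [a]
   plus [2 * K] for [c], which depends on both position and velocity. *)
have [K [K1 HK]] := acP (B + x) v; exists K; split => // e /andP[e0 ex].
have [Q [P [sol close]]] := lim v e0; exists Q, P.
have close' t : u <= t <= v -> `|Q t - q t| <= e /\ `|P t - p t| <= e.
  by move=> /andP[ut tv]; apply: close; rewrite (le_trans su).
split => //; first exact: approx_solution_sub sol.
move=> t utv; have [Qe Pe] := close' t utv.
have stv : s <= t <= v by move: utv => /andP[ut ->]; rewrite (le_trans su).
have pB := HB t stv.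
have PB : `|P t| <= B + x.
  by have := ler_normD (P t - p t) (p t); rewrite subrK; lra.
have pB' : `|p t| <= B + x by lra.
have [ha hc _] := HK (Q t) (q t) (P t) (p t) t t PB pB' stv stv.
rewrite subrr normr0 !addr0 in ha; rewrite subrr normr0 !addr0 in hc.
rewrite (_ : _ - _ = (a (Q t) t - a (q t) t) -
  (c (Q t) (P t) t - c (q t) (p t) t)); last by ring.
rewrite (le_trans (ler_normB _ _))//.
have h1 : K * `|Q t - q t| <= K * e by rewrite ler_wpM2l//; lra.
have h2 : K * `|P t - p t| <= K * e by rewrite ler_wpM2l//; lra.
by move: hc; rewrite mulrDr; lra.
Qed.

Lemma limit_solution_ge u v k : s <= u -> u <= v ->
  (forall t, u <= t <= v -> k <= a (q t) t - c (q t) (p t) t) ->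
  k * (v - u) <= p v - p u.
Proof.
move=> su uv Hk; have [K [K1 HK]] := limit_solution_net su uv ltr01.
(* Total cost of an error [e]: the slope loses [(3 * K + 2) * e], and each endpoint value of [p] is
   off by at most [e]. *)
pose D := (3 * K + 2) * (v - u) + 2.
have D0 : 0 < D by rewrite ltr_wpDl// mulr_ge0//; lra.
apply/ler_addgt0Pr => x x0.
pose e := Num.min 1 (x / D).
have e0 : 0 < e by rewrite lt_min ltr01 divr_gt0.
have eD : e * D <= x by rewrite -ler_pdivlMr// ge_min lexx orbT.
have [|Q [P [[_ Pac ae] close field]]] := HK e; first by rewrite e0 ge_min lexx.
have : (k - 3 * K * e - 2 * e) * (v - u) <= P v - P u.
  apply: abs_continuous_growth_ge => //.
  apply: ae_lebesgueS ae => t H utv; have [_ [dp [_ Dp _ incl]]] := H utv.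
  exists dp => //; have utv' : u <= t <= v by move: utv => /andP[? ?]; rewrite !ltW.
  have := friction_incl_ge incl; have := Hk t utv'.
  by have /ler_normlP[h _] := field t utv'; lra.
have [_ /ler_normlP[_ h1]] := close v (ltac:(by rewrite uv lexx)).
have [_ /ler_normlP[h2 _]] := close u (ltac:(by rewrite uv lexx)).
by rewrite /D in eD; lra.
Qed.

Lemma limit_solution_le u v k h : s <= u -> u <= v -> 0 < h ->
  (forall t, u <= t <= v -> h <= p t /\ a (q t) t - c (q t) (p t) t <= k) ->
  p v - p u <= k * (v - u).
Proof.
move=> su uv h0 Hk.
have h3 : 0 < h / 3 by rewrite divr_gt0.
have [K [K1 HK]] := limit_solution_net su uv h3.
pose D := (3 * K + 2) * (v - u) + 2.
have D0 : 0 < D by rewrite ltr_wpDl// mulr_ge0//; lra.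
apply/ler_addgt0Pr => x x0.
(* With [e <= h / 3] the approximate velocity is at least [2 h / 3], hence larger than [e], as
   [friction_incl_le] requires. *)
pose e := Num.min (h / 3) (x / D).
have e0 : 0 < e by rewrite lt_min h3 divr_gt0.
have eD : e * D <= x by rewrite -ler_pdivlMr// ge_min lexx orbT.
have eh : e <= h / 3 by rewrite ge_min lexx.
have [|Q [P [[_ Pac ae] close field]]] := HK e; first by rewrite e0 eh.
have : P v - P u <= (k + 3 * K * e + 2 * e) * (v - u).
  apply: abs_continuous_growth => //.
  apply: ae_lebesgueS ae => t H utv; have [_ [dp [_ Dp _ incl]]] := H utv.
  exists dp => //; have utv' : u <= t <= v by move: utv => /andP[? ?]; rewrite !ltW.
  have [hp ack] := Hk t utv'; have [_ /ler_normlP[hP _]] := close t utv'.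
  have ep : e < P t by lra.
  have := friction_incl_le ep incl.
  by have /ler_normlP[_ h1] := field t utv'; lra.
have [_ /ler_normlP[h1 _]] := close v (ltac:(by rewrite uv lexx)).
have [_ /ler_normlP[_ h2]] := close u (ltac:(by rewrite uv lexx)).
by rewrite /D in eD; lra.
Qed.

Lemma limit_solution_position_ge u v k : s <= u -> u <= v ->
  (forall t, u <= t <= v -> k <= p t) -> k * (v - u) <= q v - q u.
Proof.
move=> su uv Hk; have [K [K1 HK]] := limit_solution_net su uv ltr01.
pose D := 2 * (v - u) + 2.
have D0 : 0 < D by rewrite ltr_wpDl// mulr_ge0//; lra.
apply/ler_addgt0Pr => x x0.
pose e := Num.min 1 (x / D).
have e0 : 0 < e by rewrite lt_min ltr01 divr_gt0.
have eD : e * D <= x by rewrite -ler_pdivlMr// ge_min lexx orbT.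
have [|Q [P [[Qac _ ae] close _]]] := HK e; first by rewrite e0 ge_min lexx.
have : (k - 2 * e) * (v - u) <= Q v - Q u.
  apply: abs_continuous_growth_ge => //.
  apply: ae_lebesgueS ae => t H utv; have [dq [_ [Dq _ /ler_normlP[h1 _] _]]] := H utv.
  exists dq => //; have utv' : u <= t <= v by move: utv => /andP[? ?]; rewrite !ltW.
  by have := Hk t utv'; have [_ /ler_normlP[h2 _]] := close t utv'; lra.
have [/ler_normlP[_ h1] _] := close v (ltac:(by rewrite uv lexx)).
have [/ler_normlP[h2 _] _] := close u (ltac:(by rewrite uv lexx)).
by rewrite /D in eD; lra.
Qed.

End limit_solution_increments.

(** * Limits solve the inclusion exactly *)

Section limit_solution_exact.
Context {R : realType}.
Local Notation mu := (@lebesgue_measure R).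

Lemma increments_is_derive (f : R -> R) (x d : R) :
  (forall e, 0 < e -> exists2 r, 0 < r & forall u v, x - r < u -> u <= v -> v < x + r ->
    `|f v - f u - d * (v - u)| <= e * (v - u)) ->
  is_derive x (1 : R) f d.
Proof.
move=> H; apply: increment_is_derive => e e0; have [r r0 Hr] := H e e0.
exists r => // y; rewrite ltr_distlC => /andP[ry yr].
have [xy|/ltW yx] := leP x y.
  by rewrite (ger0_norm (x := y - x)) ?subr_ge0//; apply: Hr => //; lra.
rewrite distrC (distrC y x) (ger0_norm (x := x - y)) ?subr_ge0//.
have -> : d * (y - x) - (f y - f x) = f x - f y - d * (x - y) by ring.
by apply: Hr => //; lra.
Qed.

Definition admissible_field (a : R -> R -> R) (c : R -> R -> R -> R) s A :=
  [/\ forall q t, s <= t -> `|a q t| <= A, forall q p t, 0 <= c q p t &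
    forall P T, exists K, lipschitz_field a c s T P K].

Lemma admissible_fieldN a c s A : admissible_field a c s A ->
  admissible_field (reflect_drift a) (reflect_friction c) s A.
Proof.
move=> [aA c0 acP]; split; [|by move=> *; exact: c0|].
  by move=> q t st; rewrite normrN; exact: aA.
by move=> P T; have [K /lipschitz_fieldN] := acP P T; exists K.
Qed.

Definition bounded_limit_solution a c s (q p : R -> R) :=
  limit_solution a c s q p /\
  forall T, exists B, forall t, s <= t <= T -> `|p t| <= B.

Lemma bounded_limit_solutionN a c s q p : bounded_limit_solution a c s q p ->
  bounded_limit_solution (reflect_drift a) (reflect_friction c) s (\- q) (\- p).
Proof.
move=> [lim pB]; split; first exact: limit_solutionN.
by move=> T; have [B HB] := pB T; exists B => t tT; rewrite normrN; exact: HB.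
Qed.

Section lipschitz.
Variables (a : R -> R -> R) (c : R -> R -> R -> R) (s A : R) (q p : R -> R).
Hypotheses (adm : admissible_field a c s A) (sol : bounded_limit_solution a c s q p).

(** Half of the Lipschitz property, in a section of its own so that it is generalized over the field
    and can be applied to the reflected solution as well. *)
Lemma limit_solution_lower T : exists M, 0 < M /\ forall u v, s <= u -> u <= v -> v <= T ->
  - M * (v - u) <= p v - p u /\ - M * (v - u) <= q v - q u.
Proof.
have [aA c0 acP] := adm; have [lim pB] := sol.
have [B HB] := pB T; have [K [K1 HK]] := acP B T.
exists (`|A| + K + `|B|); split; first by rewrite ltr_wpDr// ltr_wpDl//; lra.
move=> u v su uv vT.
have stT t : u <= t <= v -> s <= t <= T.
  by move=> /andP[ut tv]; rewrite (le_trans su)//= (le_trans tv).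
have AB := normr_ge0 B; split.
  apply: (limit_solution_ge acP pB lim) => // t /stT st.
  have pt := HB t st; have [_ _ /andP[_ cK]] := HK (q t) (q t) _ _ t t pt pt st st.
  have /ler_normlP[h _] := aA (q t) t (ltac:(by case/andP: st)).
  by have := ler_norm A; lra.
apply: (limit_solution_position_ge acP pB lim) => // t /stT st.
have /ler_normlP[h _] := HB t st; have := ler_norm B; have := normr_ge0 A; lra.
Qed.

End lipschitz.

Section derivatives.
Variables (a : R -> R -> R) (c : R -> R -> R -> R) (s A : R) (q p : R -> R).
Hypotheses (adm : admissible_field a c s A) (sol : bounded_limit_solution a c s q p).

Lemma limit_solution_lipschitz T : exists M, 0 < M /\ forall u v,
  s <= u <= T -> s <= v <= T ->
  `|p v - p u| <= M * `|v - u| /\ `|q v - q u| <= M * `|v - u|.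
Proof.
have [M [M0 HM]] := limit_solution_lower adm sol T.
have [N [N0 HN]] := limit_solution_lower (admissible_fieldN adm)
  (bounded_limit_solutionN sol) T.
suff H u v : s <= u -> u <= v -> v <= T ->
    `|p v - p u| <= (M + N) * (v - u) /\ `|q v - q u| <= (M + N) * (v - u).
  exists (M + N); split; first exact: addr_gt0.
  move=> u v /andP[su uT] /andP[sv vT]; have [uv|/ltW vu] := leP u v.
    by rewrite (ger0_norm (x := v - u)) ?subr_ge0//; exact: H.
  rewrite distrC (distrC (q v)) (distrC v) (ger0_norm (x := u - v)) ?subr_ge0//.
  exact: H.
move=> su uv vT; have [h1 h2] := HM _ _ su uv vT; have [h3 h4] := HN _ _ su uv vT.
have Mv : 0 <= M * (v - u) by rewrite mulr_ge0 ?subr_ge0// ltW.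
have Nv : 0 <= N * (v - u) by rewrite mulr_ge0 ?subr_ge0// ltW.
by rewrite /= in h3 h4; split; apply/ler_normlP; split; lra.
Qed.

Lemma limit_solution_field_lipschitz T : exists L, 0 < L /\ forall u v,
  s <= u <= T -> s <= v <= T ->
  `|a (q v) v - a (q u) u| <= L * `|v - u| /\
  `|c (q v) (p v) v - c (q u) (p u) u| <= L * `|v - u|.
Proof.
have [aA c0 acP] := adm; have [lim pB] := sol.
have [B HB] := pB T; have [K [K1 HK]] := acP B T.
have [M [M0 HM]] := limit_solution_lipschitz T.
exists (K * (2 * M + 1)); split; first by rewrite mulr_gt0//; lra.
move=> u v su sv; have [hp hq] := HM u v su sv.
have [ha hc _] := HK (q v) (q u) (p v) (p u) v u (HB v sv) (HB u su) sv su.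
have Mv : 0 <= M * `|v - u| by rewrite mulr_ge0// ltW.
split.
  by rewrite (le_trans ha)// -mulrA ler_wpM2l//; lra.
by rewrite (le_trans hc)// -mulrA ler_wpM2l//; lra.
Qed.

(** Since [p] is Lipschitz, increments of [q] near [t] are squeezed between slopes [p t - e] and
    [p t + e]; the result holds at every [t > s], not just almost everywhere. *)
Lemma limit_solution_position_derive t : s < t -> is_derive t (1 : R) q (p t).
Proof.
move=> st; have [aA c0 acP] := adm; have [lim pB] := sol.
have [_ _ acPN] := admissible_fieldN adm.
have [limN pBN] := bounded_limit_solutionN sol.
have [M [M0 HM]] := limit_solution_lipschitz (t + 1).
apply: increments_is_derive => e e0.
exists (Num.min (Num.min (t - s) 1) (e / M)).
  by rewrite !lt_min subr_gt0 st ltr01 divr_gt0.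
set r := Num.min _ _ => u v ru uv vr.
have rs : r <= t - s by rewrite !ge_min lexx.
have r1 : r <= 1 by rewrite !ge_min lexx !orbT.
have rM : r * M <= e by rewrite -ler_pdivlMr// ge_min lexx orbT.
have su : s <= u by lra.
have near x : u <= x <= v -> `|p x - p t| <= e.
  move=> /andP[ux xv]; have [||h _] := HM t x; [by apply/andP; split; lra..|].
  rewrite (le_trans h)// (le_trans _ rM)// mulrC ler_wpM2r ?(ltW M0)//.
  by apply/ler_normlP; split; lra.
have h1 : (p t - e) * (v - u) <= q v - q u.
  apply: (limit_solution_position_ge acP pB lim) => // x /near /ler_normlP[h _].
  by lra.
have h2 : (- p t - e) * (v - u) <= (\- q) v - (\- q) u.
  apply: (limit_solution_position_ge acPN pBN limN) => // x /near /ler_normlP[_ h].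
  by rewrite /=; lra.
by rewrite /= in h2; apply/ler_normlP; split; lra.
Qed.

Lemma limit_solution_derive_gt0 t : s < t -> 0 < p t ->
  is_derive t (1 : R) p (a (q t) t - c (q t) (p t) t).
Proof.
move=> st pt; have [aA c0 acP] := adm; have [lim pB] := sol.
have [M [M0 HM]] := limit_solution_lipschitz (t + 1).
have [L [L0 HL]] := limit_solution_field_lipschitz (t + 1).
apply: increments_is_derive => e e0.
(* The bound with [L] keeps [a - c] within [e], each of [a] and [c] contributing half; the bound
   with [M] keeps the velocity above [p t / 2]. *)
exists (Num.min (Num.min (t - s) 1) (Num.min (e / (2 * L)) (p t / 2 / M))).
  by rewrite !lt_min subr_gt0 st ltr01 !divr_gt0// mulr_gt0.
set r := Num.min _ _ => u v ru uv vr.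
have rs : r <= t - s by rewrite !ge_min lexx.
have r1 : r <= 1 by rewrite !ge_min lexx !orbT.
have rL : r * (2 * L) <= e by rewrite -ler_pdivlMr ?mulr_gt0// !ge_min lexx !orbT.
have rM : r * M <= p t / 2 by rewrite -ler_pdivlMr// !ge_min lexx !orbT.
have su : s <= u by lra.
have near x : u <= x <= v -> p t / 2 <= p x /\
    `|(a (q x) x - c (q x) (p x) x) - (a (q t) t - c (q t) (p t) t)| <= e.
  move=> /andP[ux xv]; have xr : `|x - t| <= r by apply/ler_normlP; split; lra.
  have [||hp _] := HM t x; [by apply/andP; split; lra..|].
  have [||ha hc] := HL t x; [by apply/andP; split; lra..|].
  have Mr : M * `|x - t| <= M * r by rewrite ler_wpM2l ?(ltW M0).
  have Lr : L * `|x - t| <= L * r by rewrite ler_wpM2l ?(ltW L0).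
  split; first by move: hp => /ler_normlP[h _]; lra.
  rewrite (_ : _ - _ = (a (q x) x - a (q t) t) -
    (c (q x) (p x) x - c (q t) (p t) t)); last by ring.
  by rewrite (le_trans (ler_normB _ _))//; lra.
have h1 := limit_solution_ge acP pB lim su uv
  (k := a (q t) t - c (q t) (p t) t - e) _.
have h2 := limit_solution_le acP pB lim su uv
  (k := a (q t) t - c (q t) (p t) t + e) (h := p t / 2) (divr_gt0 pt (ltr0Sn R 1)) _.
have {}h1 : _ <= _ := h1 (fun x xuv => ltac:(
  by have [_ /ler_normlP[? ?]] := near x xuv; lra)).
have {}h2 : _ <= _ := h2 (fun x xuv => ltac:(
  by have [? /ler_normlP[? ?]] := near x xuv; split; lra)).
by apply/ler_normlP; split; lra.
Qed.

(** If the drift exceeded the maximal friction, the velocity would leave zero at a positive rate,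
    against its zero derivative. *)
Lemma limit_solution_zero_ge t : s < t -> p t = 0 -> is_derive t (1 : R) p 0 ->
  a (q t) t <= c (q t) (p t) t.
Proof.
move=> st pt Dp; have [aA c0 acP] := adm; have [lim pB] := sol.
rewrite leNgt; apply/negP => ca.
(* The excess is [4 * d]; [a] and [c] each lose at most [d] up to [y], so [p] gains slope [2 * d],
   whereas the zero derivative allows only [d]. *)
pose d := (a (q t) t - c (q t) (p t) t) / 4.
have d0 : 0 < d by rewrite divr_gt0// subr_gt0.
have [L [L0 HL]] := limit_solution_field_lipschitz (t + 1).
have [r r0 Hr] := is_derive_increment Dp d0.
pose y := t + Num.min (Num.min (r / 2) 1) (d / L).
have ty : 0 < y - t.
  by rewrite /y addrAC subrr add0r !lt_min ltr01 (divr_gt0 d0 L0) divr_gt0.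
have yr : y - t <= r / 2 by rewrite /y addrAC subrr add0r !ge_min lexx.
have y1 : y - t <= 1 by rewrite /y addrAC subrr add0r !ge_min lexx !orbT.
have yL : (y - t) * L <= d.
  by rewrite -ler_pdivlMr// /y addrAC subrr add0r !ge_min lexx !orbT.
have : 2 * d * (y - t) <= p y - p t.
  apply: (limit_solution_ge acP pB lim) => [||x /andP[tx xy]]; [lra..|].
  have [||ha hc] := HL t x; [by apply/andP; split; lra..|].
  have Lx : L * `|x - t| <= L * (y - t).
    by rewrite ler_wpM2l ?(ltW L0)// ger0_norm; lra.
  by move: ha hc => /ler_normlP[? ?] /ler_normlP[? ?]; rewrite /d in yL *; lra.
have := Hr y; rewrite (gtr0_norm ty) mul0r subr0 => /(_ ltac:(lra)) /ler_normlP[_ h].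
have : 0 < d * (y - t) by rewrite mulr_gt0.
by lra.
Qed.

Lemma limit_solution_zero_derive T :
  {ae mu, forall t, s < t < T -> p t = 0 -> is_derive t (1 : R) p 0}.
Proof.
have [sT|Ts] := leP s T; last first.
  by apply: aeW => t /andP[/lt_trans h /h]; rewrite ltNge (ltW Ts).
have [M [M0 HM]] := limit_solution_lipschitz T.
(* Clamping time turns [p] into a Lipschitz function on the whole line, as the density argument
   requires, without changing it near interior points. *)
pose clamp t := Num.max s (Num.min t T).
have clampE t : s <= t <= T -> clamp t = t.
  by move=> /andP[st tT]; rewrite /clamp min_l// max_r.
have clampT t : s <= clamp t <= T by rewrite /clamp le_max lexx ge_max sT ge_min lexx orbT.
have clamp_lip x y : `|clamp x - clamp y| <= `|x - y|.
  wlog xy : x y / y <= x => [H|].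
    by have [/H//|/ltW /H] := leP y x; rewrite distrC (distrC y).
  rewrite (ger0_norm (x := x - y)) ?subr_ge0// ler_norml /clamp !maxEle !minEle.
  case: (leP x T) => xT; case: (leP y T) => yT; case: (leP s x) => sx;
  case: (leP s y) => sy; rewrite ?sT; apply/andP; split; lra.
have plip x y : `|p (clamp x) - p (clamp y)| <= M * `|x - y|.
  have [h _] := HM (clamp y) (clamp x) (clampT y) (clampT x).
  by rewrite (le_trans h)// ler_wpM2l// ltW.
apply: ae_lebesgueS (lipschitz_zero_derive plip) => t H /andP[st tT] pt.
have stT : s <= t <= T by rewrite !ltW.
have Dt := H (ltac:(by rewrite clampE)).
apply: increment_is_derive => e e0; have [r r0 Hr] := is_derive_increment Dt e0.
exists (Num.min r (Num.min (t - s) (T - t))); first by rewrite !lt_min r0 !subr_gt0 st.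
move=> y; rewrite !lt_min => /and3P[yr ys yT].
have := Hr y yr; rewrite !clampE//.
by move: ys yT => /ltr_normlP[? ?] /ltr_normlP[? ?]; apply/andP; split; lra.
Qed.

End derivatives.

Lemma limit_solution_exact a c s A q p T : admissible_field a c s A ->
  bounded_limit_solution a c s q p -> approx_solution a c 0 s T q p.
Proof.
move=> adm sol; have [_ c0 _] := adm.
have admN := admissible_fieldN adm; have solN := bounded_limit_solutionN sol.
have [M [M0 HM]] := limit_solution_lipschitz adm sol T.
have Hlip u v : s <= u -> u <= v -> v <= T ->
    `|p v - p u| <= M * (v - u) /\ `|q v - q u| <= M * (v - u).
  move=> su uv vT; have := HM u v; rewrite (ger0_norm (x := v - u)) ?subr_ge0//.
  by apply; rewrite ?su ?(le_trans uv)// (le_trans su).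
split.
- apply: (@lipschitz_abs_continuous _ _ _ M) => u v su uv vT.
  exact: (Hlip u v su uv vT).2.
- apply: (@lipschitz_abs_continuous _ _ _ M) => u v su uv vT.
  exact: (Hlip u v su uv vT).1.
apply: ae_lebesgueS (limit_solution_zero_derive adm sol T) => t Hz tT.
have st : s < t by case/andP: tT.
have Dq := limit_solution_position_derive adm sol st.
have [p0|p0|p0] := ltrgt0P (p t).
- have Dp := limit_solution_derive_gt0 adm sol st p0.
  exists (p t), (a (q t) t - c (q t) (p t) t); split => //; first by rewrite subrr normr0.
  exists (c (q t) (p t) t), (p t); rewrite subrr normr0 subr0 addr0 ger0_norm// gtr0_norm//.
  by split => //; [rewrite mulrC|rewrite (_ : _ + _ = 0) ?normr0//; ring].
- have pN : 0 < (\- p) t by rewrite /= oppr_gt0.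
  have := limit_solution_derive_gt0 admN solN st pN.
  rewrite /reflect_drift /reflect_friction/= !opprK => /is_deriveN.
  rewrite (_ : (- \- p) = p) => [Dp|]; last by apply/funext => x; rewrite !fctE/= opprK.
  exists (p t), (- (- a (q t) t - c (q t) (p t) t)); split => //; first by rewrite subrr normr0.
  exists (- c (q t) (p t) t), (p t).
  rewrite subrr normr0 subr0 addr0 normrN ger0_norm// ltr0_norm//.
  by split => //; [rewrite !mulrN mulrC|rewrite (_ : _ + _ = 0) ?normr0//; ring].
(* Sticking: friction balances the drift, so [w] is [a (q t) t]. Its two bounds come from
   [limit_solution_zero_ge] for the solution and for its reflection. *)
- have Dp := Hz tT p0.
  exists (p t), 0; split => //; first by rewrite subrr normr0.
  exists (a (q t) t), 0; rewrite p0 subrr normr0 mulr0 mul0r sub0r addNr normr0 addr0.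
  split => //; apply/ler_normlP; split; last first.
    by have := limit_solution_zero_ge adm sol st p0 Dp; rewrite p0.
  have DpN : is_derive t (1 : R) (\- p) 0 by rewrite -oppr0; exact: is_deriveN.
  have := limit_solution_zero_ge admN solN st _ DpN.
  by rewrite /reflect_drift /reflect_friction/= !opprK p0 oppr0; apply.
Qed.

End limit_solution_exact.

(** * Exits from the strip *)

Section shooting.
Context {R : realType}.
Implicit Types (a : R -> R -> R) (c : R -> R -> R -> R) (f g q p : R -> R) (s : R).

(** Both inequalities are strict, so that the property survives small uniform perturbations, as mere
    contact with [be] would not. *)
Definition exits_above s (al be : R) f := exists t, [/\ s <= t, be < f t &
  forall x, s <= x <= t -> al < f x].

Definition exits_below s al be f := exits_above s (- be) (- al) (\- f).

Lemma lipschitz_gap s t M al f : s <= t ->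
  (forall x y, s <= x <= t -> s <= y <= t -> `|f y - f x| <= M * `|y - x|) ->
  (forall x, s <= x <= t -> al < f x) ->
  exists d, 0 < d /\ forall x, s <= x <= t -> al + d <= f x.
Proof.
move=> st fM fal; pose N := `|M| + 1.
have N0 : 0 < N by rewrite ltr_wpDl.
have {}fM x y : s <= x <= t -> s <= y <= t -> `|f y - f x| <= N * `|y - x|.
  move=> sx sy; rewrite (le_trans (fM x y sx sy))// ler_wpM2r//.
  by rewrite (le_trans (ler_norm M))// lerDl.
suff /(_ t) : forall x, s <= x <= t ->
    exists d, 0 < d /\ forall y, s <= y <= x -> al + d <= f y.
  by apply; rewrite st lexx.
apply: real_induction => x sxt IH.
pose h := (f x - al) / 2.
have h0 : 0 < h by rewrite divr_gt0// subr_gt0 fal.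
have near y : s <= y <= t -> `|y - x| <= h / N -> al + h <= f y.
  move=> syt yx; have := fM x y sxt syt.
  have : N * `|y - x| <= h by rewrite mulrC -ler_pdivlMr.
  have hE : h * 2 = f x - al by rewrite /h divfK.
  by move=> ? /ler_normlP[? ?]; lra.
have r0 : 0 < h / N by rewrite divr_gt0.
have [sx xt] := andP sxt.
have [d [d0 Hd]] : exists d, 0 < d /\
    forall y, s <= y <= Num.max s (x - h / N) -> s <= y < x -> al + d <= f y.
  have [sx'|xs] := ltP s x; last first.
    exists 1; split => // y _ /andP[sy yx]; lra.
  have [|d [d0 Hd]] := IH (Num.max s (x - h / N)).
    by rewrite le_max lexx gt_max sx'/= gtrBl.
  by exists d; split => // y /Hd.
exists (h / N) => // v /andP[xv vt] vx; exists (Num.min d h).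
split; first by rewrite lt_min d0.
move=> y /andP[sy yv].
have [yw|wy] := leP y (x - h / N).
  rewrite (@le_trans _ _ (al + d)) ?lerD2l ?ge_min ?lexx// Hd//.
    by rewrite sy le_max yw orbT.
  by rewrite sy; lra.
rewrite (@le_trans _ _ (al + h)) ?lerD2l ?ge_min ?lexx ?orbT// near//.
  by rewrite sy (le_trans yv).
by apply/ler_normlP; split; lra.
Qed.

Lemma exits_above_open s al be f :
  (forall T, exists M, 0 < M /\ forall x y, s <= x <= T -> s <= y <= T ->
    `|f y - f x| <= M * `|y - x|) ->
  exits_above s al be f ->
  exists T d, [/\ s <= T, 0 < d & forall g,
    (forall x, s <= x <= T -> `|g x - f x| <= d) -> exits_above s al be g].
Proof.
move=> flip [t [st ft fal]]; have [M [M0 HM]] := flip t.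
have [d [d0 Hd]] := lipschitz_gap st HM fal.
exists t, (Num.min (d / 2) ((f t - be) / 2)); split => //.
  by rewrite lt_min !divr_gt0// subr_gt0.
move=> g gf; exists t.
have gf' x : s <= x <= t -> `|g x - f x| <= d / 2 /\ `|g x - f x| <= (f t - be) / 2.
  by move=> /gf; rewrite le_min => /andP[].
split => //.
  by have [_ /ler_normlP[h _]] := gf' t (ltac:(by rewrite st lexx)); lra.
move=> x sx; have [/ler_normlP[h _] _] := gf' x sx; have := Hd x sx; lra.
Qed.

(** At the earlier of the two exit times, the other exit demands that the function still lie on the
    opposite side of the bound just crossed. *)
Lemma exits_above_below s al be f :
  exits_above s al be f -> exits_below s al be f -> False.
Proof.
move=> [t [st ft fal]] [u [su fu fbe]]; have [tu|/ltW ut] := leP t u.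
  by have := fbe t; rewrite st tu => /(_ isT) /=; lra.
by have := fal u; rewrite su ut => /(_ isT) /=; rewrite /= in fu; lra.
Qed.

Section exit.
Variables (a : R -> R -> R) (c : R -> R -> R -> R) (s A : R) (q p : R -> R) (al be : R).
Hypotheses (adm : admissible_field a c s A) (sol : bounded_limit_solution a c s q p).
Hypothesis out_be : forall t, s <= t -> c be 0 t < a be t.

(** A positive velocity persists by continuity; from zero velocity, [out_be] makes the drift beat
    friction. The linear lower bound covers both cases, as [r <= 1]. *)
Lemma velocity_grows_at_exit t : s <= t -> q t = be -> 0 <= p t ->
  exists k r, [/\ 0 < k, 0 < r & forall x, t <= x <= t + r -> k * (x - t) <= p x].
Proof.
move=> st qt pt; have [aA c0 acP] := adm; have [lim pB] := sol.
have [pt0|pt0] := ltP 0 (p t).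
  have [M [M0 HM]] := limit_solution_lipschitz adm sol (t + 1).
  exists (p t / 2), (Num.min 1 (p t / 2 / M)).
  split; [by rewrite divr_gt0|by rewrite lt_min ltr01 !divr_gt0|].
  set r := Num.min _ _ => x /andP[tx xr].
  have r1 : r <= 1 by rewrite ge_min lexx.
  have rM : r * M <= p t / 2 by rewrite -ler_pdivlMr// ge_min lexx orbT.
  have [||h _] := HM t x; [by apply/andP; split; lra..|].
  move: h; rewrite (ger0_norm (x := x - t)) ?subr_ge0// => /ler_normlP[h _].
  have : M * (x - t) <= M * r by rewrite ler_wpM2l ?(ltW M0)//; lra.
  have : p t / 2 * (x - t) <= p t / 2 * 1 by rewrite ler_wpM2l ?divr_ge0//; lra.
  by lra.
have {pt pt0} pt0 : p t = 0 by apply/eqP; rewrite eq_le pt pt0.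
pose d := (a be t - c be 0 t) / 4.
have d0 : 0 < d by rewrite divr_gt0// subr_gt0 out_be.
have [L [L0 HL]] := limit_solution_field_lipschitz adm sol (t + 1).
exists (2 * d), (Num.min 1 (d / L)).
split; [by rewrite mulr_gt0|by rewrite lt_min ltr01 divr_gt0|].
set r := Num.min _ _ => x /andP[tx xr].
have r1 : r <= 1 by rewrite ge_min lexx.
have rL : r * L <= d by rewrite -ler_pdivlMr// ge_min lexx orbT.
suff : 2 * d * (x - t) <= p x - p t by rewrite pt0 subr0.
apply: (limit_solution_ge acP pB lim) => // y /andP[ty yx].
have [||ha hc] := HL t y; [by apply/andP; split; lra..|].
have Ly : L * `|y - t| <= L * r by rewrite ler_wpM2l ?(ltW L0)// ger0_norm; lra.
move: ha hc; rewrite qt pt0 => /ler_normlP[? ?] /ler_normlP[? ?].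
by rewrite /d in rL *; lra.
Qed.

(** Contact turns into strict crossing by integrating the velocity bound. The case [t = s] is
    allowed, so that the shooting endpoint itself exits. *)
Lemma exits_above_at t : s <= t -> q t = be -> 0 <= p t -> al < be ->
  (forall x, s <= x < t -> al < q x) -> exits_above s al be q.
Proof.
move=> st qt pt ab qal; have [aA c0 acP] := adm; have [lim pB] := sol.
have [k [r [k0 r0 Hr]]] := velocity_grows_at_exit st qt pt.
have grow x : t <= x <= t + r -> be <= q x.
  move=> /andP[tx xr]; rewrite -qt -subr_ge0 -(mul0r (x - t)).
  apply: (limit_solution_position_ge acP pB lim) => // y /andP[ty yx].
  rewrite (le_trans _ (Hr y _))//; last by apply/andP; split; lra.
  by rewrite mulr_ge0 ?(ltW k0)// subr_ge0.
exists (t + r); split; first lra.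
  (* The lower bound on the velocity vanishes at [t]; on the second half of the interval it is at
     least [k * (r / 2)], which yields strict growth. *)
  have qm : be <= q (t + r / 2) by apply: grow; apply/andP; split; lra.
  have : k * (r / 2) * (t + r - (t + r / 2)) <= q (t + r) - q (t + r / 2).
    apply: (limit_solution_position_ge acP pB lim) => [||x /andP[tx xr]]; [lra..|].
    rewrite (le_trans _ (Hr x _))//; last by apply/andP; split; lra.
    by rewrite ler_wpM2l ?(ltW k0)//; lra.
  have : 0 < k * (r / 2) * (r / 2) by rewrite !mulr_gt0.
  by lra.
move=> x /andP[sx xt]; have [xt'|tx] := ltP x t; first by rewrite qal ?sx.
by rewrite (lt_le_trans ab)// grow// tx.
Qed.

End exit.

Section trapped.
Variables (a : R -> R -> R) (c : R -> R -> R -> R) (s A : R) (q p : R -> R) (al be : R).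
Hypotheses (adm : admissible_field a c s A) (sol : bounded_limit_solution a c s q p).
Hypothesis ab : al < be.

Lemma velocity_ge0_at_exit t : s < t -> q t = be ->
  (forall x, s <= x < t -> q x < be) -> 0 <= p t.
Proof.
move=> st qt qbe; rewrite leNgt; apply/negP => pt.
have Dq := limit_solution_position_derive adm sol st.
have e0 : 0 < - p t / 2 by rewrite divr_gt0// oppr_gt0.
have [r r0 Hr] := is_derive_increment Dq e0.
pose y := t - Num.min (r / 2) ((t - s) / 2).
have m0 : 0 < Num.min (r / 2) ((t - s) / 2) by rewrite lt_min !divr_gt0// subr_gt0.
have mr : Num.min (r / 2) ((t - s) / 2) <= r / 2 by rewrite ge_min lexx.
have ms : Num.min (r / 2) ((t - s) / 2) <= (t - s) / 2 by rewrite ge_min lexx orbT.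
have := Hr y; rewrite /y; set m := Num.min _ _ in m0 mr ms *.
rewrite (_ : t - m - t = - m); last by ring.
rewrite normrN (gtr0_norm m0) qt => /(_ ltac:(lra)) /ler_normlP[h1 _].
have := qbe (t - m) ltac:(by apply/andP; split; lra).
have : 0 < - p t * m by rewrite mulr_gt0// oppr_gt0.
by lra.
Qed.

Hypothesis out_be : forall t, s <= t -> c be 0 t < a be t.

(** Continuity gives [q t <= be]. Equality would be a first contact, hence with nonnegative
    velocity, and [exits_above_at] would turn it into an exit. *)
Lemma below_until_exit t : s < t -> ~ exits_above s al be q ->
  (forall x, s <= x < t -> al < q x < be) -> q t < be.
Proof.
move=> st nexit Hq.
have [M [M0 HM]] := limit_solution_lipschitz adm sol t.
have qt : q t <= be.
  apply/ler_addgt0Pr => e e0.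
  pose y := Num.max s (t - e / M).
  have yt : y < t by rewrite gt_max st gtrBl divr_gt0.
  have sy : s <= y by rewrite le_max lexx.
  have [||_ h] := HM y t; [by rewrite sy ltW|by rewrite ltW/=|].
  have /andP[_ hy] := Hq y (ltac:(by rewrite sy)).
  have hM : (t - y) * M <= e.
    by rewrite -ler_pdivlMr// lerBlDr -lerBlDl le_max lexx orbT.
  move: h; rewrite (ger0_norm (x := t - y)) ?subr_ge0 ?(ltW yt)//.
  by move=> /ler_normlP[_ ?]; lra.
rewrite lt_neqAle qt andbT; apply/eqP => qbe; apply: nexit.
apply: (exits_above_at adm sol out_be (ltW st) qbe _ ab); last first.
  by move=> x /Hq/andP[].
by apply: velocity_ge0_at_exit => // x /Hq/andP[].
Qed.

End trapped.

Lemma trapped_forever a c s A q p al be : admissible_field a c s A ->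
  bounded_limit_solution a c s q p -> al < be ->
  (forall t, s <= t -> c be 0 t < a be t) ->
  (forall t, s <= t -> a al t < - c al 0 t) ->
  al < q s < be -> ~ exits_above s al be q -> ~ exits_below s al be q ->
  forall t, s <= t -> al < q t < be.
Proof.
move=> adm sol ab obe oal qs na nb T sT.
have [M [M0 HM]] := limit_solution_lipschitz adm sol T.
suff /(_ T) : forall x, s <= x <= T -> al < q x < be by apply; rewrite sT lexx.
apply: real_induction => x /andP[sx xT] IH.
have qx : al < q x < be.
  move: sx; rewrite le_eqVlt => /orP[/eqP <-//|sx].
  have -> : q x < be by apply: (below_until_exit adm sol ab).
  rewrite andbT.
  have admN := admissible_fieldN adm; have solN := bounded_limit_solutionN sol.
  have abN : - be < - al by rewrite ltrN2.
  have := below_until_exit admN solN abN _ sx nb.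
  rewrite ltrN2; apply => [t st|t /IH]; last by rewrite !ltrN2 andbC.
  by rewrite /reflect_drift /reflect_friction opprK oppr0; have := oal t st; lra.
pose d := Num.min (q x - al) (be - q x).
have d0 : 0 < d by move: qx => /andP[? ?]; rewrite lt_min !subr_gt0; apply/andP.
exists (d / M); first by rewrite divr_gt0.
move=> v /andP[xv vT] vx.
have [||_] := HM x v; [by rewrite sx|by rewrite (le_trans sx)|].
rewrite (ger0_norm (x := v - x)) ?subr_ge0// => h.
have : M * (v - x) < d by rewrite mulrC -ltr_pdivlMr//; lra.
rewrite lt_min => /andP[h1 h2].
by move: h => /ler_normlP[? ?]; apply/andP; split; lra.
Qed.

End shooting.

(** * Connectedness argument *)

Section viable_solution.
Context {R : realType}.

Lemma exact_solution_unique a c s A (q p q' p' : R -> R) :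
  admissible_field a c s A ->
  (forall T, approx_solution a c 0 s T q p) ->
  (forall T, approx_solution a c 0 s T q' p') ->
  q s = q' s -> p s = p' s -> forall t, s <= t -> q t = q' t.
Proof.
move=> [_ _ acP] sol sol' qs ps t st.
have [_ pac _] := sol t; have [_ pac' _] := sol' t.
have [B HB] := abs_continuous_bounded pac; have [B' HB'] := abs_continuous_bounded pac'.
have [K acK] := acP (Num.max B B') t.
have pB x : s <= x <= t -> `|p x| <= Num.max B B'.
  by move=> /HB h; rewrite le_max h.
have pB' x : s <= x <= t -> `|p' x| <= Num.max B B'.
  by move=> /HB' h; rewrite le_max h orbT.
have e01 : 0 <= (0 : R) <= 1 by rewrite lexx ler01.
have stt : s <= t <= t by rewrite st lexx.
have := approx_solution_comparison acK e01 (sol t) (sol' t) pB pB' stt.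
rewrite qs ps !subrr expr0n mul0r !addr0 mul0r => h.
have /eqP : (q t - q' t) ^+ 2 = 0.
  by apply/eqP; rewrite eq_le sqr_ge0 andbT (le_trans _ h)// lerDl sqr_ge0.
by rewrite sqrf_eq0 subr_eq0 => /eqP.
Qed.

Lemma continuous_dependence a c s A (Q P : R -> R -> R) T :
  admissible_field a c s A -> s <= T ->
  (forall x, approx_solution a c 0 s T (Q x) (P x)) ->
  (forall x, Q x s = x /\ P x s = 0) ->
  (forall x t, s <= t <= T -> `|P x t| <= A * (T - s + 1)) ->
  exists L, 0 < L /\ forall x y t, s <= t <= T -> `|Q x t - Q y t| <= L * `|x - y|.
Proof.
move=> [_ _ acP] sT sol init PB.
have [K acK] := acP (A * (T - s + 1)) T; have K1 := acK.1.
(* [L] bounds the ratio of squared distances; as [L >= 1], it is below its own square and so also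
   bounds the ratio of distances, with no square root. *)
pose L := expR ((3 + 4 * K) * (T - s)).
have L1 : 1 <= L by rewrite -expR0 ler_expR mulr_ge0//; lra.
have L0 : 0 < L by lra.
exists L; split => // x y t tT.
have e01 : 0 <= (0 : R) <= 1 by rewrite lexx ler01.
have := approx_solution_comparison acK e01 (sol x) (sol y) (PB x) (PB y) tT.
have [-> ->] := init x; have [-> ->] := init y.
rewrite subrr expr0n mul0r !addr0 -/L => h.
rewrite -(@ler_pXn2r _ 2)// ?nnegrE ?mulr_ge0 ?(ltW L0)// exprMn !real_normK ?num_real//.
have : (Q x t - Q y t) ^+ 2 <= (x - y) ^+ 2 * L.
  by rewrite (le_trans _ h)// lerDl sqr_ge0.
have : (x - y) ^+ 2 * L <= (x - y) ^+ 2 * (L * L).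
  by rewrite ler_wpM2l ?sqr_ge0// ler_peMl// ltW.
by rewrite expr2 [X in _ <= X]mulrC; lra.
Qed.

Theorem viable_solution_exists a c s A (al be : R) : admissible_field a c s A ->
  al < be ->
  (forall t, s <= t -> c be 0 t < a be t) ->
  (forall t, s <= t -> a al t < - c al 0 t) ->
  exists q0, [/\ al < q0 < be,
    exists q p, [/\ forall T, approx_solution a c 0 s T q p, q s = q0 & p s = 0] &
    forall q p, (forall T, approx_solution a c 0 s T q p) -> q s = q0 -> p s = 0 ->
      forall t, s <= t -> al < q t < be].
Proof.
move=> adm ab obe oal; have [aA c0 acP] := adm.
have A0 : 0 <= A by rewrite (le_trans _ (aA 0 s _)).
have /choice[F HF] : forall x, exists qp : (R -> R) * (R -> R),
    [/\ limit_solution a c s qp.1 qp.2, qp.1 s = x, qp.2 s = 0 &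
      forall t, s <= t -> `|qp.2 t| <= A * (t - s + 1)].
  move=> x; have [q [p [h1 h2 h3 h4]]] := limit_solution_exists x 0 aA c0 acP.
  by exists (q, p); split => // t /h4; rewrite normr0 add0r.
pose Q x := (F x).1; pose P x := (F x).2.
have lim x : bounded_limit_solution a c s (Q x) (P x).
  have [h _ _ PA] := HF x; split => // T; exists (A * (T - s + 1)) => t /andP[st tT].
  by rewrite (le_trans (PA t st))// ler_wpM2l//; lra.
have init x : Q x s = x /\ P x s = 0 by have [] := HF x.
have exact_sol x T : approx_solution a c 0 s T (Q x) (P x).
  exact: limit_solution_exact adm (lim x).
have Qlip x T : exists M, 0 < M /\ forall u v, s <= u <= T -> s <= v <= T ->
    `|Q x v - Q x u| <= M * `|v - u|.
  have [M [M0 HM]] := limit_solution_lipschitz adm (lim x) T.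
  by exists M; split => // u v su sv; have [] := HM u v su sv.
have dep T d : s <= T -> 0 < d -> exists2 r, 0 < r & forall x y, `|x - y| < r ->
    forall t, s <= t <= T -> `|Q y t - Q x t| <= d.
  move=> sT d0; have [|L [L0 HL]] := continuous_dependence adm sT (exact_sol^~ T) init.
    move=> x t /andP[st tT]; have [_ _ _ PA] := HF x.
    by rewrite (le_trans (PA t st))// ler_wpM2l//; lra.
  exists (d / L); first by rewrite divr_gt0.
  move=> x y xy t tT; rewrite distrC (le_trans (HL x y t tT))//.
  by rewrite mulrC -ler_pdivlMr// ltW.
have above_open x : exits_above s al be (Q x) -> exists2 r, 0 < r &
    forall y, `|x - y| < r -> exits_above s al be (Q y).
  move=> /exits_above_open => /(_ (Qlip x)) [T [d [sT d0 Hd]]].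
  have [r r0 Hr] := dep T d sT d0; exists r => // y xy; apply: Hd; exact: Hr.
have below_open x : exits_below s al be (Q x) -> exists2 r, 0 < r &
    forall y, `|x - y| < r -> exits_below s al be (Q y).
  move=> /exits_above_open [|T [d [sT d0 Hd]]].
    move=> T; have [M [M0 HM]] := Qlip x T; exists M; split => // u v su sv.
    by rewrite /= -opprD normrN; exact: HM.
  have [r r0 Hr] := dep T d sT d0; exists r => // y xy; apply: Hd => t tT.
  by rewrite /= -opprD normrN; exact: Hr.
have above_be : exits_above s al be (Q be).
  apply: (exits_above_at adm (lim be) obe (lexx s)) => //.
  - by have [] := init be.
  - by have [_ ->] := init be.
  - by move=> x /andP[sx xs]; move: (le_lt_trans sx xs); rewrite ltxx.
have below_al : exits_below s al be (Q al).
  apply: (exits_above_at (admissible_fieldN adm) (bounded_limit_solutionN (lim al)) _ (lexx s)).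
  - move=> t st; have := oal t st.
    by rewrite /reflect_drift /reflect_friction opprK oppr0; lra.
  - by have [/= -> _] := init al.
  - by have [_ /= ->] := init al; rewrite oppr0.
  - by rewrite ltrN2.
  - by move=> x /andP[sx xs]; move: (le_lt_trans sx xs); rewrite ltxx.
have [q0 [q0ab na nb]] : exists q0, [/\ al <= q0 <= be,
    ~ exits_above s al be (Q q0) & ~ exits_below s al be (Q q0)].
  apply: contrapT => none.
  have dich x : al <= x <= be -> exits_above s al be (Q x) \/ exits_below s al be (Q x).
    by move=> xab; apply: contrapT => /not_orP[na nb]; apply: none; exists x.
  (* Real induction would propagate the exit below from [al] up to [be], whose trajectory exits
     above. *)
  suff /(_ be) : forall x, al <= x <= be -> exits_below s al be (Q x).
    by rewrite lexx (ltW ab) => /(_ isT); exact: exits_above_below.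
  apply: real_induction => x /[dup] xab /andP[alx xbe] IH.
  have [xa|xb] := dich x xab; last first.
    have [r r0 Hr] := below_open x xb; exists r => // v /andP[xv vbe] vx.
    by apply: Hr; apply/ltr_normlP; split; lra.
  (* By openness some smaller initial position would exit above, while the induction hypothesis
     makes it exit below; [x] differs from [al], so such a position exists. *)
  exfalso; have [r r0 Hr] := above_open x xa.
  have ax : al < x.
    rewrite lt_neqAle alx andbT; apply/eqP => alxE.
    by apply: (exits_above_below xa); rewrite -alxE.
  have [wx wr] : Num.max al (x - r / 2) < x /\ x - r / 2 <= Num.max al (x - r / 2).
    by split; rewrite ?le_max ?lexx ?orbT// gt_max ax gtrBl divr_gt0.
  apply: (exits_above_below (Hr (Num.max al (x - r / 2)) _) (IH _ _)).
    by apply/ltr_normlP; split; lra.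
  by rewrite le_max lexx wx.
have q0ab' : al < q0 < be.
  move: q0ab; rewrite !le_eqVlt => /andP[/orP[/eqP alE|->] /orP[/eqP beE|->]] //.
  - by case: nb; rewrite -alE.
  - by case: nb; rewrite -alE.
  - by case: na; rewrite beE.
exists q0; split => //.
  by exists (Q q0), (P q0); have [? ?] := init q0; split.
move=> q p sol qs ps t st.
have [Qs Ps] := init q0.
rewrite (exact_solution_unique adm sol (exact_sol q0) _ _ st) ?Qs ?Ps//.
by apply: (trapped_forever adm (lim q0) ab obe oal) => //; rewrite Qs.
Qed.

End viable_solution.

(** * The pendulum as drift and friction *)

Section pendulum_field.
Context {R : realType}.

Lemma derive_lipschitz1 (f df : R -> R) :
  (forall x, is_derive x (1 : R) f (df x)) -> (forall x, `|df x| <= 1) ->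
  forall x y, `|f x - f y| <= `|x - y|.
Proof.
move=> Df df1 x y; wlog yx : x y / y <= x => [H|].
  by have [/H//|/ltW/H] := leP y x; rewrite distrC (distrC y).
have [|z _ ->] := @MVT_segment R f df y x yx (fun z _ => Df z).
  by apply: continuous_subspaceT => z; apply: differentiable_continuous; apply/derivable1_diffP; case: (Df z).
by rewrite normrM ler_piMl.
Qed.

Lemma sin_lipschitz (x y : R) : `|sin x - sin y| <= `|x - y|.
Proof. by apply: derive_lipschitz1 => z; exact: cos_max. Qed.

Lemma cos_lipschitz (x y : R) : `|cos x - cos y| <= `|x - y|.
Proof.
apply: (@derive_lipschitz1 cos (fun z => - sin z)) => z.
by rewrite normrN sin_max.
Qed.

Variables (l g mu : R) (h : R -> R).

Definition pendulum_drift (q t : R) : R := h t / l * sin q - g / l * cos q.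

Definition pendulum_friction (q p t : R) : R :=
  mu / l * `|h t * cos q - l * p ^+ 2 + g * sin q|.

Lemma pendulum_field_lipschitz (s T P Kh H : R) :
  0 < l -> 0 < g -> 0 < mu -> 0 <= Kh -> 0 <= H ->
  (forall t t', `|h t - h t'| <= Kh * `|t - t'|) ->
  (forall t, s <= t <= T -> `|h t| <= H) ->
  exists K, lipschitz_field pendulum_drift pendulum_friction s T P K.
Proof.
move=> l_gt0 g_gt0 mu_gt0 nK nH hK hH.
pose N : R := `|P|; have nP : 0 <= N by exact: normr_ge0.
(* [K0 / l] is the Lipschitz constant of the drift. [K1] adds [2 * l * N] for the Lipschitz constant
   of the square of the velocity, and [l * (N * N)] so that it also bounds the normal force
   itself. *)
pose K0 : R := Kh + H + g.
pose K1 : R := Kh + H + g + 2 * l * N + l * (N * N).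
have lP : 0 <= l * N by rewrite mulr_ge0// ltW.
have lPP : 0 <= l * (N * N) by rewrite !mulr_ge0// ltW.
have K0K1 : K0 <= K1 by rewrite /K0 /K1; lra.
have ml : 0 < mu / l by rewrite divr_gt0.
have K00 : 0 <= K0 by rewrite /K0; lra.
have K0l : 0 <= K0 / l by rewrite divr_ge0 ?(ltW l_gt0).
have K1l : 0 <= mu / l * K1 by rewrite mulr_ge0 ?(ltW ml)//; lra.
exists (1 + K0 / l + mu / l * K1); split; first by lra.
move=> q q' p p' t t' pP pP' st st'.
have hle u : s <= u <= T -> `|h u| <= H by exact: hH.
have hd : `|h t - h t'| <= Kh * `|t - t'| by exact: hK.
have prod (f : R -> R) : (forall x, `|f x| <= 1) ->
    (forall x y, `|f x - f y| <= `|x - y|) ->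
    `|h t * f q - h t' * f q'| <= Kh * `|t - t'| + H * `|q - q'|.
  move=> f1 flip.
  rewrite (_ : _ - _ = (h t - h t') * f q + h t' * (f q - f q')); last by ring.
  rewrite (le_trans (ler_normD _ _))// !normrM lerD//.
    by rewrite (le_trans _ hd)// ler_piMr.
  by rewrite ler_pM// hle.
have lin (f : R -> R) : (forall x y, `|f x - f y| <= `|x - y|) ->
    `|g * f q - g * f q'| <= g * `|q - q'|.
  by move=> flip; rewrite -mulrBr normrM (gtr0_norm g_gt0) ler_wpM2l// ltW.
have pP1 : `|p| <= N by rewrite (le_trans pP)// ler_norm.
have pP1' : `|p'| <= N by rewrite (le_trans pP')// ler_norm.
have sq : `|l * p ^+ 2 - l * p' ^+ 2| <= 2 * l * N * `|p - p'|.
  rewrite (_ : _ - _ = l * ((p + p') * (p - p'))); last by ring.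
  rewrite !normrM (gtr0_norm l_gt0) (_ : 2 * l * _ * _ = l * (2 * N * `|p - p'|)); last by ring.
  rewrite ler_wpM2l ?(ltW l_gt0)// ler_wpM2r// (le_trans (ler_normD _ _))//; lra.
have dq0 : (0 : R) <= `|q - q'| by [].
have dp0 : (0 : R) <= `|p - p'| by [].
have dt0 : (0 : R) <= `|t - t'| by [].
have mono (x y k : R) : 0 <= x -> 0 <= k -> 0 <= y -> k <= y -> k * x <= y * x.
  by move=> *; rewrite ler_wpM2r.
split.
- have h1 := prod sin (@sin_max R) sin_lipschitz.
  have h2 := lin cos cos_lipschitz.
  rewrite (_ : _ - _ = ((h t * sin q - h t' * sin q') -
    (g * cos q - g * cos q')) / l); last by rewrite /pendulum_drift; ring.
  rewrite normrM (gtr0_norm (_ : 0 < l^-1)) ?invr_gt0//.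
  rewrite (@le_trans _ _ (K0 / l * (`|q - q'| + `|t - t'|)))//; last first.
    by rewrite ler_wpM2r ?addr_ge0//; lra.
  rewrite mulrAC ler_wpM2r ?invr_ge0 ?(ltW l_gt0)// (le_trans (ler_normB _ _))//.
  have : 0 <= Kh * `|q - q'| by rewrite mulr_ge0.
  have : 0 <= (H + g) * `|t - t'| by rewrite mulr_ge0//; lra.
  by rewrite /K0; lra.
- have h1 := prod cos (@cos_max R) cos_lipschitz.
  have h2 := lin sin sin_lipschitz.
  rewrite /pendulum_friction -mulrBr normrM (gtr0_norm ml).
  rewrite (@le_trans _ _ (mu / l * (K1 * (`|q - q'| + `|p - p'| + `|t - t'|))))//; last first.
    rewrite mulrA ler_wpM2r ?addr_ge0//; lra.
  rewrite ler_wpM2l ?(ltW ml)// (le_trans (ler_dist_dist _ _))//.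
  rewrite (_ : _ - _ = (h t * cos q - h t' * cos q') -
    (l * p ^+ 2 - l * p' ^+ 2) + (g * sin q - g * sin q')); last by ring.
  rewrite (le_trans (ler_normD _ _))//.
  have := ler_normB (h t * cos q - h t' * cos q') (l * p ^+ 2 - l * p' ^+ 2).
  have c1 : 0 <= (Kh + 2 * l * N + l * (N * N)) * `|q - q'| by rewrite mulr_ge0//; lra.
  have c2 : 0 <= (Kh + H + g + l * (N * N)) * `|p - p'| by rewrite mulr_ge0//; lra.
  have c3 : 0 <= (H + g + 2 * l * N + l * (N * N)) * `|t - t'| by rewrite mulr_ge0//; lra.
  by rewrite /K1; lra.
- rewrite /pendulum_friction mulr_ge0 ?(ltW ml)//=.
  rewrite (@le_trans _ _ (mu / l * K1))//; last by lra.
  rewrite ler_wpM2l ?(ltW ml)//.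
  have a1 : `|h t * cos q| <= H * 1 by rewrite normrM ler_pM ?cos_max ?hle.
  have a2 : `|g * sin q| <= g * 1.
    by rewrite normrM (gtr0_norm g_gt0) ler_wpM2l ?sin_max ?(ltW g_gt0).
  have a3 : `|l * p ^+ 2| <= l * (N * N).
    by rewrite normrM (gtr0_norm l_gt0) normrX expr2 ler_wpM2l ?(ltW l_gt0)// ler_pM.
  rewrite (le_trans (ler_normD _ _))//.
  have := ler_normB (h t * cos q) (l * p ^+ 2).
  by rewrite /K1; lra.
Qed.

Lemma lipschitz_bound : lipschitz h ->
  exists2 M, 0 <= M & forall t t', `|h t - h t'| <= M * `|t - t'|.
Proof.
move=> [M [_ HM]]; exists (`|M| + 1); first exact: addr_ge0.
move=> t t'; have := HM (`|M| + 1) _ (t, t') (conj I I); apply.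
by rewrite (le_lt_trans (ler_norm M))// ltrDl.
Qed.

(** The set-valued map varies only [q] and [p] at a frozen time, where the value of [h t] is its own
    bound; hence no restriction on [t]. *)
Lemma pendulum_field_lipschitz_at P t : 0 < l -> 0 < g -> 0 < mu -> lipschitz h ->
  exists K, lipschitz_field pendulum_drift pendulum_friction t t P K.
Proof.
move=> l_gt0 g_gt0 mu_gt0 /lipschitz_bound[M M0 HM].
apply: (@pendulum_field_lipschitz t t P M `|h t|) => //.
by move=> u; rewrite -eq_le => /eqP ->.
Qed.

(** The smallness hypothesis doubles as the bound [g / mu] on the pivot acceleration, which gives
    the global drift bound [(g / mu + g) / l]. *)
Lemma pendulum_admissible s : 0 < l -> 0 < g -> 0 < mu ->
  lipschitz h -> (forall t, s <= t -> mu * `|h t| < g) ->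
  admissible_field pendulum_drift pendulum_friction s ((g / mu + g) / l).
Proof.
move=> l_gt0 g_gt0 mu_gt0 hlip hsmall.
have hb t : s <= t -> `|h t| <= g / mu.
  by move=> /hsmall/ltW; rewrite mulrC ler_pdivlMr.
split.
- move=> q t st; rewrite /pendulum_drift.
  rewrite (_ : _ - _ = (h t * sin q - g * cos q) / l); last by ring.
  rewrite normrM (gtr0_norm (_ : 0 < l^-1)) ?invr_gt0// ler_wpM2r ?invr_ge0 ?(ltW l_gt0)//.
  rewrite (le_trans (ler_normB _ _))// !normrM (gtr0_norm g_gt0) lerD//.
    by rewrite (le_trans _ (hb t st))// ler_piMr// sin_max.
  by rewrite ler_piMr ?cos_max// ltW.
- by move=> q p t; rewrite /pendulum_friction mulr_ge0// divr_ge0// ltW.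
- move=> P T; have [M M0 HM] := lipschitz_bound hlip.
  apply: (@pendulum_field_lipschitz s T P M (g / mu)); rewrite ?divr_ge0 ?(ltW g_gt0) ?(ltW mu_gt0)//.
  by move=> t /andP[st _]; exact: hb.
Qed.

(** At [q = pi] the sine vanishes and the cosine is [-1]: the drift is [g / l], the friction at rest
    [mu / l] times the absolute value of [h t], so this is the smallness hypothesis divided by
    [l]. *)
Lemma pendulum_leaves_pi t : 0 < l -> mu * `|h t| < g ->
  pendulum_friction pi 0 t < pendulum_drift pi t.
Proof.
move=> l_gt0 hg; rewrite /pendulum_friction /pendulum_drift cospi sinpi expr0n/=.
rewrite !mulr0 subr0 addr0 sub0r !mulrN1 normrN opprK mulrAC ltr_pM2r ?invr_gt0//.
Qed.

Lemma pendulum_leaves_0 t : 0 < l -> mu * `|h t| < g ->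
  pendulum_drift 0 t < - pendulum_friction 0 0 t.
Proof.
move=> l_gt0 hg; rewrite /pendulum_friction /pendulum_drift cos0 sin0 expr0n/=.
rewrite !mulr0 subr0 addr0 sub0r !mulr1 ltrN2 mulrAC ltr_pM2r ?invr_gt0//.
Qed.

End pendulum_field.

(** * Identification of the set-valued map *)

Section pendulum_inclusion.
Context {R : realType}.
Variables (l g mu : R) (xi : R -> R).
Local Notation h := (derive1n 2 xi).
Local Notation a := (pendulum_drift l g h).
Local Notation c := (pendulum_friction l g mu h).
Local Notation Phi := (pendulum_Phi l g mu xi).

Lemma pendulum_rhsE (q p t : R) :
  pendulum_rhs l g mu xi t (q, p) = (p, a q t - c q p t * (p / `|p|)).
Proof.
rewrite /pendulum_rhs /pendulum_drift /pendulum_friction; congr pair.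
by set b := h t; set n := `| _ |; ring.
Qed.

Lemma friction_incl_coulomb (a0 c0 p : R) : p != 0 -> 0 <= c0 ->
  friction_incl a0 c0 0 p (a0 - c0 * (p / `|p|)).
Proof.
move=> p0 c00.
have sE : p * (p / `|p|) = `|p|.
  by rewrite mulrA -expr2 -real_normK ?num_real// expr2 mulfK// normr_eq0.
exists (c0 * (p / `|p|)), p; rewrite subrr normr0 addr0 subr0; split => //.
- rewrite normrM (ger0_norm c00) normrM normfV normr_id divff ?mulr1//.
  by rewrite normr_eq0.
- by rewrite mulrCA sE.
- by rewrite (_ : _ + _ = 0) ?normr0//; ring.
Qed.

(** The witnesses depend on [e], so instead of extracting a limit [d] is identified: it equals
    [a0 - c0] if [p > 0], the mirrored value if [p < 0], and is only bounded if [p = 0]. *)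
Lemma friction_incl_closed (a0 c0 p d : R) : 
  (forall e, 0 < e -> friction_incl a0 c0 e p d) -> friction_incl a0 c0 0 p d.
Proof.
move=> H.
have gt0 (a1 p1 d1 : R) : 0 < p1 ->
    (forall e, 0 < e -> friction_incl a1 c0 e p1 d1) -> d1 = a1 - c0.
  move=> p0 H1; apply/eqP; rewrite eq_le; apply/andP; split.
    apply/ler_addgt0Pr => e e0.
    pose x := Num.min (e / 2) (p1 / 2).
    have x0 : 0 < x by rewrite lt_min !divr_gt0.
    have xp : x < p1 by rewrite gt_min; apply/orP; right; lra.
    have xe : x <= e / 2 by rewrite ge_min lexx.
    by have := friction_incl_le xp (H1 x x0); lra.
  apply/ler_addgt0Pr => e e0.
  by have := friction_incl_ge (H1 (e / 2) (divr_gt0 e0 (ltr0Sn R 1))); lra.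
have normc : `|a0 - d| <= c0.
  apply/ler_addgt0Pr => e e0.
  have [w [z [_ wc _ dw]]] := H (e / 2) (divr_gt0 e0 (ltr0Sn R 1)).
  rewrite (_ : a0 - d = w - (d - a0 + w)); last by ring.
  by rewrite (le_trans (ler_normB _ _))//; lra.
exists (a0 - d), p; rewrite subrr normr0 addr0 subr0; split => //; last first.
  by rewrite (_ : _ + _ = 0) ?normr0//; ring.
have [p0|p0|->] := ltrgt0P p; last by rewrite mulr0 mul0r.
  by rewrite (gt0 a0 p d p0 H) subKr mulrC.
have pN : 0 < - p by rewrite oppr_gt0.
have := gt0 (- a0) (- p) (- d) pN (fun e e0 => friction_inclN (H e e0)).
move=> dE; have -> : a0 - d = - c0 by lra.
by rewrite !mulrN mulrC.
Qed.

Hypothesis cP : forall P t, exists K, lipschitz_field a c t t P K.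

(** A cluster value is near values of the field at points within [r] with nonzero velocity. Moving
    Coulomb's law from there to [(q, p)] costs at most [K * r] in the drift, [2 * K * r] in the
    friction and [r] in the values; then [r] tends to zero. *)
Lemma pendulum_limit_values_incl (q p t : R) z :
  pendulum_limit_values l g mu xi t (q, p) z ->
  z.1 = p /\ friction_incl (a q t) (c q p t) 0 p z.2.
Proof.
move=> zlim; have [K [K1 HK]] := cP (`|p| + 1) t.
have near r : 0 < r <= 1 -> `|z.1 - p| <= 2 * r /\
    friction_incl (a q t) (c q p t) (3 * K * r + r) p z.2.
  move=> /andP[r0 r1].
  pose A := [set y : R^o * R^o | ball ((q, p) : R^o * R^o) r y /\ y.2 != 0].
  have FA : (pendulum_rhs l g mu xi t @ within [set y | y.2 != 0] (nbhs ((q, p) : R^o * R^o)))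
      (pendulum_rhs l g mu xi t @` A).
    by apply/nbhs_ballP; exists r => //= y qpy y2; exists y.
  have FB : nbhs z (ball z r) by exact: nbhsx_ballx.
  have [_ [[[q' p'] [[qq pp] p'0] <-]]] := zlim _ _ FA FB.
  rewrite pendulum_rhsE => -[z1 z2].
  have {}qq : `|q - q'| < r := qq.
  have {}pp : `|p - p'| < r := pp.
  have {}z1 : `|z.1 - p'| < r := z1.
  set d := a q' t - _ in z2; have {}z2 : `|z.2 - d| < r := z2.
  have pP : `|p| <= `|p| + 1 by rewrite lerDl.
  have p'P : `|p'| <= `|p| + 1.
    have := ler_normD p (p' - p); rewrite addrC subrK distrC; lra.
  have tt : t <= t <= t by rewrite lexx.
  have [ha hc /andP[c'0 _]] := HK q' q p' p t t p'P pP tt tt.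
  rewrite subrr normr0 !addr0 distrC in ha; rewrite subrr normr0 !addr0 distrC in hc.
  have K0 : 0 <= K by lra.
  have h1 : K * `|q' - q| <= K * r by rewrite ler_wpM2l// distrC ltW.
  have h2 : K * `|p' - p| <= K * r by rewrite ler_wpM2l// distrC ltW.
  have Kr : 0 <= K * r by rewrite mulr_ge0// ltW.
  split.
    rewrite (_ : z.1 - p = (z.1 - p') - (p - p')); last by ring.
    by rewrite (le_trans (ler_normB _ _))//; lra.
  have [w [y [yp wc cw dw]]] := friction_incl_coulomb (a q' t) p'0 c'0.
  have yE : y = p'.
    by apply/eqP; rewrite -subr_eq0 -normr_le0.
  rewrite mulrDr in hc; move: hc ha; rewrite !ler_norml => /andP[hc1 hc2] /andP[ha1 ha2].
  exists w, y; split.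
  - by rewrite yE distrC; clear - cP pp Kr; lra.
  - by clear - cP wc hc1 hc2 h1 h2 Kr r0; lra.
  - by rewrite (le_trans _ cw)// ler_wpM2r//; clear - cP hc1 hc2 h1 h2 Kr r0; lra.
  - move: dw z2; rewrite -/d => /ler_normlP[dw1 dw2] /ltr_normlP[z1' z2'].
    by apply/ler_normlP; clear - cP ha1 ha2 h1 Kr dw1 dw2 z1' z2'; split; lra.
split.
  apply/eqP; rewrite -subr_eq0 -normr_le0; apply/ler_addgt0Pr => e e0; rewrite add0r.
  have [|h1 _] := near (Num.min 1 (e / 2)).
    by rewrite lt_min ltr01 divr_gt0//= ge_min lexx.
  rewrite (le_trans h1)// mulrC -ler_pdivlMr// ge_min lexx orbT//.
apply: friction_incl_closed => e e0.
have K0 : 0 < 3 * K + 1 by lra.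
have [|_ h1] := near (Num.min 1 (e / (3 * K + 1))).
  by rewrite lt_min ltr01 divr_gt0//= ge_min lexx.
apply: friction_incl_le_error h1.
set r := Num.min _ _.
have : r * (3 * K + 1) <= e by rewrite -ler_pdivlMr// ge_min lexx orbT.
by lra.
Qed.

Lemma closed_friction_incl (a0 c0 p : R) :
  closed [set z : R^o * R^o | z.1 = p /\ friction_incl a0 c0 0 p z.2].
Proof.
move=> z zcl.
have near r : 0 < r -> `|z.1 - p| <= r /\ friction_incl a0 c0 r p z.2.
  move=> r0; have [y [[y1 [w [x [xp wc cx dw]]]] [z1 z2]]] := zcl _ (nbhsx_ballx z r r0).
  have {}z1 : `|z.1 - y.1| < r := z1.
  have {}z2 : `|z.2 - y.2| < r := z2.
  split; first by rewrite -y1 ltW.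
  exists w, x; split.
  - by rewrite (le_trans xp)// ltW.
  - by rewrite (le_trans wc)// lerD2l ltW.
  - by rewrite (le_trans _ cx)// ler_wpM2r// lerD2l lerN2 ltW.
  - move: dw z2 => /ler_normlP[? ?] /ltr_normlP[? ?].
    by apply/ler_normlP; split; lra.
split; last by apply: friction_incl_closed => e /near[].
apply/eqP; rewrite -subr_eq0 -normr_le0; apply/ler_addgt0Pr => e e0.
by rewrite add0r; have [] := near e e0.
Qed.

(** Zero error forces [z = p] and [w = a0 - d]; what remains is visibly convex in [d]. *)
Lemma friction_incl_exactP (a0 c0 p d : R) : friction_incl a0 c0 0 p d <->
  `|a0 - d| <= c0 /\ c0 * `|p| <= p * (a0 - d).
Proof.
split => [[w [z [zp wc cw dw]]]|[h1 h2]]; last first.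
  exists (a0 - d), p; rewrite subrr normr0 addr0 subr0; split => //.
  by rewrite (_ : _ + _ = 0) ?normr0//; ring.
have -> : a0 - d = w.
  have E : a0 - d - w = - (d - a0 + w) by ring.
  by apply/eqP; rewrite -subr_eq0 -normr_le0 E normrN.
have zE : z = p by apply/eqP; rewrite -subr_eq0 -normr_le0.
by rewrite addr0 in wc; rewrite subr0 zE in cw.
Qed.

Lemma convex_friction_incl (a0 c0 p : R) :
  convex_set [set z : R^o * R^o | z.1 = p /\ friction_incl a0 c0 0 p z.2].
Proof.
move=> [x1 x2] [y1 y2] k; rewrite !inE /= => -[-> /friction_incl_exactP[hx1 hx2]].
move=> [-> /friction_incl_exactP[hy1 hy2]].
pose r : R := k%:num.
have r0 : 0 <= r by rewrite /r.
have r1 : 0 <= 1 - r by rewrite subr_ge0 /r.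
suff : r * p + (1 - r) * p = p /\ friction_incl a0 c0 0 p (r * x2 + (1 - r) * y2) by [].
split; first by ring.
apply/friction_incl_exactP.
have -> : a0 - (r * x2 + (1 - r) * y2) = r * (a0 - x2) + (1 - r) * (a0 - y2) by ring.
split.
  rewrite (le_trans (ler_normD _ _))// !normrM (ger0_norm r0) (ger0_norm r1).
  by have := ler_wpM2l r0 hx1; have := ler_wpM2l r1 hy1; lra.
by have := ler_wpM2l r0 hx2; have := ler_wpM2l r1 hy2; lra.
Qed.

Lemma pendulum_Phi_incl (q p t : R) z : Phi q p t z ->
  z.1 = p /\ friction_incl (a q t) (c q p t) 0 p z.2.
Proof.
move=> /(_ [set z : R^o * R^o | z.1 = p /\ friction_incl (a q t) (c q p t) 0 p z.2]).
apply; split; last by move=> y; exact: pendulum_limit_values_incl.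
by split; [exact: closed_friction_incl|exact: convex_friction_incl].
Qed.

(** The point is approached along [p + d * e] with [d > 0], whose sign is exactly [e]; at [p = 0]
    both sides are available and give the two extreme accelerations. *)
Lemma pendulum_limit_value_side (q p t e : R) : `|e| = 1 -> 0 <= p * e ->
  pendulum_limit_values l g mu xi t (q, p) (p, a q t - c q p t * e).
Proof.
move=> e1 pe A B /nbhs_ballP[r /= r0 HA] /nbhs_ballP[r' /= r'0 HB].
have [K [K1 HK]] := cP (`|p| + 1) t.
pose d := Num.min (Num.min 1 (r / 2)) (Num.min (r' / 2) (r' / (2 * K))).
have K0 : 0 < K by lra.
have d0 : 0 < d by rewrite !lt_min ltr01 !divr_gt0// mulr_gt0.
have d1 : d <= 1 by rewrite !ge_min lexx.
have dr : d <= r / 2 by rewrite !ge_min lexx orbT.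
have dr' : d <= r' / 2 by rewrite !ge_min lexx !orbT.
have dK : d * (2 * K) <= r' by rewrite -ler_pdivlMr ?mulr_gt0// !ge_min lexx !orbT.
pose p' := p + d * e.
have ee : e * e = 1 by rewrite -expr2 -real_normK ?num_real// e1 expr1n.
have pp' : `|p - p'| = d.
  by rewrite /p' opprD addrA subrr add0r normrN normrM e1 mulr1 gtr0_norm.
have p'e : p' * e = p * e + d by rewrite /p' mulrDl -mulrA ee mulr1.
have p'e0 : 0 < p' * e by rewrite p'e; lra.
have p'0 : p' != 0 by apply: contraTneq p'e0 => ->; rewrite mul0r ltxx.
have p'n : p' / `|p'| = e.
  have -> : `|p'| = p' * e by rewrite -[RHS](ger0_norm (ltW p'e0)) normrM e1 mulr1.
  have e0 : e != 0 by rewrite -normr_eq0 e1 oner_eq0.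
  by rewrite invfM mulrA divff// mul1r -[LHS]mulr1 -ee mulrA mulVf// mul1r.
exists (pendulum_rhs l g mu xi t (q, p')); split.
  apply: HA => //; split; first by rewrite /= /ball/= subrr normr0.
  by rewrite /ball/= pp'; lra.
apply: HB; rewrite pendulum_rhsE p'n; split.
  by rewrite /ball/= pp'; lra.
have tt : t <= t <= t by rewrite lexx.
have pP : `|p| <= `|p| + 1 by rewrite lerDl.
have p'P : `|p'| <= `|p| + 1.
  by have := ler_normB p (p - p'); rewrite subKr pp'; lra.
have [_ hc _] := HK q q p' p t t p'P pP tt tt.
rewrite !subrr normr0 add0r addr0 (distrC p') pp' in hc.
suff : `|(a q t - c q p t * e) - (a q t - c q p' t * e)| < r' by [].
rewrite (_ : _ - _ = (c q p' t - c q p t) * e); last by ring.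
by rewrite normrM e1 mulr1 (le_lt_trans hc)//; lra.
Qed.

Lemma incl_pendulum_Phi (q p t d : R) :
  friction_incl (a q t) (c q p t) 0 p d -> Phi q p t (p, d).
Proof.
move=> /friction_incl_exactP[h1 h2] A [[Acl Acvx] Alim].
have side e : `|e| = 1 -> 0 <= p * e -> A (p, a q t - c q p t * e).
  by move=> e1 pe; apply: Alim; exact: pendulum_limit_value_side.
have abs1 : `|1| = 1 :> R by rewrite normr1.
have absN1 : `|-1| = 1 :> R by rewrite normrN1.
have [p0|p0|p0] := ltrgt0P p.
- have := side 1 abs1; rewrite !mulr1 => /(_ (ltW p0)).
  suff -> : d = a q t - c q p t by [].
  rewrite gtr0_norm// mulrC ler_pM2l// in h2.
  by move: h1 => /ler_normlP[? ?]; lra.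
- have := side (-1) absN1; rewrite !mulrN1 => /(_ ltac:(lra)).
  suff -> : d = a q t - - c q p t by [].
  rewrite ltr0_norm// mulrN mulrC -mulrN ler_nM2l// in h2.
  by move: h1 => /ler_normlP[? ?]; lra.
have := side 1 abs1; have := side (-1) absN1; rewrite p0 !mul0r lexx mulr1 mulrN1.
rewrite p0 in h1.
set c0 := c q 0 t in h1 *; set a0 := a q t in h1 * => /(_ isT) hN /(_ isT) hP.
have [c00|c00] := eqVneq c0 0.
  suff -> : d = a0 - c0 by [].
  by move: h1; rewrite c00 normr_le0 subr_eq0 subr0 => /eqP.
have cpos : 0 < c0 by rewrite lt_neqAle eq_sym c00 (le_trans _ h1).
(* The weight that writes [d] as a convex combination of the one-sided limits [a0 - c0] and
   [a0 + c0]; the degenerate segment [c0 = 0] was set apart above. *)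
pose r := (a0 - d + c0) / (2 * c0).
have [h3 h4] : a0 - d <= c0 /\ - c0 <= a0 - d by move: h1; rewrite ler_norml => /andP[].
have c20 : 0 < 2 * c0 by rewrite mulr_gt0.
have n0 : 0 <= a0 - d + c0 by lra.
have n1 : a0 - d + c0 <= 2 * c0 by lra.
have r0 : 0 <= r by rewrite divr_ge0// ltW.
have r1 : r <= 1 by rewrite ler_pdivrMr// mul1r.
have := Acvx (0, a0 - c0) (0, a0 - - c0) (Itv01 r0 r1).
rewrite !inE => /(_ hP hN) conv.
have {}conv : A (r * 0 + (1 - r) * 0, r * (a0 - c0) + (1 - r) * (a0 - - c0)) := conv.
rewrite !mulr0 addr0 in conv.
by suff -> : d = r * (a0 - c0) + (1 - r) * (a0 - - c0) by []; rewrite /r; field.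
Qed.

End pendulum_inclusion.

(** * Transfer to solutions of the pendulum *)

Section pendulum_solutions.
Context {R : realType}.
Local Notation mu := (@lebesgue_measure R).
Variables (l g m : R) (xi : R -> R).
Local Notation h := (derive1n 2 xi).
Local Notation a := (pendulum_drift l g h).
Local Notation c := (pendulum_friction l g m h).
Hypothesis cP : forall P t, exists K, lipschitz_field a c t t P K.

Lemma pendulum_solution_exact t0 q p :
  pendulum_solution l g m xi `[t0, +oo[ q p ->
  forall T, approx_solution a c 0 t0 T q p.
Proof.
move=> [qac pac ae] T; have [t0T|Tt0] := leP t0 T; last first.
  have vac f : abs_continuous_segment t0 T f.
    apply: (@lipschitz_abs_continuous _ _ _ 0) => x y tx xy yT.
    by move: (le_trans tx (le_trans xy yT)); rewrite leNgt Tt0.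
  split; [exact: vac|exact: vac|].
  by apply: aeW => t /andP[/lt_trans h1 /h1]; rewrite ltNge (ltW Tt0).
split.
- by apply: qac; rewrite in_itv/= andbT.
- by apply: pac; rewrite in_itv/= andbT.
apply: ae_lebesgueS ae => t H /andP[tt _].
have [|Dq Dp /(pendulum_Phi_incl cP)[/= qp incl]] := H.
  by rewrite in_itv/= andbT ltW.
exists (derive1 q t), (derive1 p t); split; last exact: incl.
- exact: derivable_is_derive1.
- exact: derivable_is_derive1.
- by rewrite qp subrr normr0.
Qed.

Lemma exact_pendulum_solution t0 q p :
  (forall T, approx_solution a c 0 t0 T q p) ->
  pendulum_solution l g m xi `[t0, +oo[ q p.
Proof.
move=> sol; split.
- move=> x y; rewrite !in_itv/= !andbT => tx ty; have [qac _ _] := sol y.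
  exact: abs_continuous_sub qac.
- move=> x y; rewrite !in_itv/= !andbT => tx ty; have [_ pac _] := sol y.
  exact: abs_continuous_sub pac.
(* The exceptional set depends on the final time; countably many final times exhaust the
   half-line. *)
have aen : {ae mu, forall t, forall n : nat, t0 < t < t0 + n%:R ->
    exists dq dp, [/\ is_derive t (1 : R) q dq, is_derive t (1 : R) p dp,
      `|dq - p t| <= 0 & friction_incl (a (q t) t) (c (q t) (p t) t) 0 (p t) dp]}.
  have H n := let: And3 _ _ ae := sol (t0 + n%:R) in ae.
  by apply: negligibleS (negligible_bigcup H) => t /existsNP[n Hn]; exists n.
(* [t0] belongs to the closed half-line, but no two-sided derivative is known there. *)
have t0n : {ae mu, forall t, t <> t0}.
  have : mu.-negligible [set t0] by apply/negligibleP => //; exact: lebesgue_measure_set1.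
  by apply: negligibleS => t /= /contrapT.
apply: ae_lebesgueS (ae_lebesgueI aen t0n) => t [H tt0].
rewrite in_itv/= andbT le_eqVlt => /orP[/eqP//|t0t]; first by move=> E; case: tt0.
have [|dq [dp [Dq Dp /[!normr_le0] /[!subr_eq0]/eqP qp incl]]] :=
    H (Num.truncn (t - t0)).+1.
  have /truncn_itv/andP[_ tn] : 0 <= t - t0 by rewrite subr_ge0 ltW.
  by rewrite t0t/=; lra.
split; [by case: Dq|by case: Dp|].
by rewrite (is_derive_derive1 Dq) (is_derive_derive1 Dp) qp; exact: incl_pendulum_Phi.
Qed.

End pendulum_solutions.

Unset Implicit Arguments.
Set Strict Implicit.

Theorem proposition2 (R : realType) (l g mu : R) (xi : R -> R) (t0 : R)
    (l_gt0 : 0 < l) (g_gt0 : 0 < g) (mu_gt0 : 0 < mu)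
    (xi_diff : forall t : R, derivable xi t 1)
    (xi_diff2 : forall t : R, derivable (derive1 xi) t 1)
    (xi_lip : lipschitz (derive1n 2 xi))
    (xi_small : forall t : R, t0 <= t -> mu * `|derive1n 2 xi t| < g) :
  exists q0 p0 : R,
    [/\ 0 < q0 < pi,
        exists q p : R -> R,
          [/\ pendulum_solution l g mu xi `[t0, +oo[ q p,
              q t0 = q0 & p t0 = p0] &
        forall q p : R -> R,
          pendulum_solution l g mu xi `[t0, +oo[ q p ->
          q t0 = q0 -> p t0 = p0 ->
          forall t : R, t0 < t -> 0 < q t < pi].
Proof.
have cP P t := pendulum_field_lipschitz_at P t l_gt0 g_gt0 mu_gt0 xi_lip.
have adm := pendulum_admissible l_gt0 g_gt0 mu_gt0 xi_lip xi_small.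
have [||q0 [q0pi [q [p [sol qs ps]]] trapped]] := viable_solution_exists adm (pi_gt0 R).
- by move=> t /xi_small; exact: pendulum_leaves_pi.
- by move=> t /xi_small; exact: pendulum_leaves_0.
exists q0, 0; split => //.
  by exists q, p; split => //; exact: exact_pendulum_solution.
move=> q' p' /(pendulum_solution_exact cP) sol' qs' ps' t /ltW.
exact: trapped.
Qed.
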